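(* Let $K\subset\mathbb{R}^n$ be compact, smoothly path-connected, and strictly forward invariant under $\dot x=f(x)$, with Jacobian $A(x)=\frac{\partial f}{\partial x}(x)$. Suppose there exist a constant $\lambda>0$ and a Finsler function $V(x,\delta_x)$, defined for $x\in K$, $\delta_x\in\mathbb{R}^n$, such that $$\frac{\partial V}{\partial x}(x,\delta_x)\,f(x)+\frac{\partial V}{\partial\delta_x}(x,\delta_x)\,A(x)\,\delta_x\le-\lambda V(x,\delta_x)$$ for all $x\in K$ and all $\delta_x\neq0$ such that $\frac{\partial V}{\partial\delta_x}(x,\delta_x)f(x)=0$. Then for every two solutions $x_1$ and $x_2$ of $\dot x=f(x)$ with initial conditions in $K$ there exists a time reparametrization $\tau(t)$ such that $x_1(t)\rightarrow x_2(\tau(t))$ as $t\to\infty$, i.e. $|x_1(t)-x_2(\tau(t))|\to0$.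
   Context: The system is the autonomous ODE $\dot x=f(x)$, $x\in\mathbb{R}^n$, with $f:K\to\mathbb{R}^n$ smooth and solutions existing and unique. A set $K$ is strictly forward invariant under $f$ if any solution with $x(0)\in K$ is in the interior of $K$ for all $t>0$. $K$ is smoothly path-connected if any two points of $K$ are joined by a smooth path remaining in $K$. A time reparametrization is a smooth monotonically increasing function $\tau:[0,\infty)\to[0,\infty)$ with $\tau(t)\to\infty$ as $t\to\infty$. A Finsler function $V(x,\delta_x)$ is a Finsler metric in the standard sense: continuous, smooth where $\delta_x\ne0$, positive for $\delta_x\neq0$, positively homogeneous of degree one in $\delta_x$, and strongly convex in $\delta_x$ (the Hessian of $\frac12V^2$ in $\delta_x$ is positive definite for $\delta_x\neq0$). The principal example is $V(x,\delta_x)=\sqrt{\delta_x'M(x)\delta_x}$ with $M(x)$ symmetric positive definite and smooth in $x$; a prime denotes transpose. *)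

(* Defs.v *)
(* MathComp-Analysis, over an arbitrary R : realType. Points and tangent vectors
   of R^n are row vectors: the Jacobian 'J f x of the library acts on the right,
   i.e. it is the transpose of the matrix (d f_i / d x_j), and the product of
   that matrix with a column d is written d *m 'J f x. *)
From mathcomp Require Import all_boot all_order all_algebra.
From mathcomp Require Import all_classical all_reals all_analysis.

Set Implicit Arguments.
Unset Strict Implicit.
Unset Printing Implicit Defensive.

Import Order.TTheory GRing.Theory Num.Theory.
Import numFieldNormedType.Exports.

Local Open Scope classical_set_scope.
Local Open Scope ring_scope.

(* 'D_v1 ('D_v2 (... ('D_vk g))) for vs = [:: v1; ...; vk] *)
Definition iter_derive (R : realType) (E F : normedModType R)
  (vs : seq E) (g : E -> F) : E -> F := foldr (fun v h => 'D_v h) g vs.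

(* C^oo on an arbitrary set A, in the usual sense: g is C^oo on some open
   neighbourhood of A. The values of g off A serve as the smooth extension
   with which derivatives at boundary points of A are computed. On the open
   set U, differentiability of every iterated directional derivative amounts
   to the continuity of the partial derivatives of all orders, E being
   finite-dimensional in all uses. *)
Definition smooth_on (R : realType) (E F : normedModType R)
    (A : set E) (g : E -> F) : Prop :=
  exists U : set E, [/\ open U, A `<=` U &
    forall vs x, U x -> differentiable (iter_derive vs g) x].

(* Together with continuity at 0, the equation for t > 0 also gives the
   right derivative f (x 0) at t = 0 when f is continuous at x 0. *)
Definition is_solution (R : realType) (n : nat)
    (f : 'rV[R]_n -> 'rV[R]_n) (x : R -> 'rV[R]_n) : Prop :=
  {within `[0, +oo[, continuous x} /\
  forall t : R, 0 < t -> is_derive t 1 x (f (x t)).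

Definition solutions_exist (R : realType) (n : nat) (K : set 'rV[R]_n)
    (f : 'rV[R]_n -> 'rV[R]_n) : Prop :=
  forall x0, K x0 -> exists x, is_solution f x /\ x 0 = x0.

Definition solutions_unique (R : realType) (n : nat) (K : set 'rV[R]_n)
    (f : 'rV[R]_n -> 'rV[R]_n) : Prop :=
  forall x y, is_solution f x -> is_solution f y -> K (x 0) -> x 0 = y 0 ->
  forall t : R, 0 <= t -> x t = y t.

Definition strictly_forward_invariant (R : realType) (n : nat)
    (K : set 'rV[R]_n) (f : 'rV[R]_n -> 'rV[R]_n) : Prop :=
  forall x, is_solution f x -> K (x 0) ->
  forall t : R, 0 < t -> interior K (x t).

Definition smoothly_path_connected (R : realType) (n : nat)
    (K : set 'rV[R]_n) : Prop :=
  forall a b, K a -> K b -> exists gamma : R -> 'rV[R]_n,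
    [/\ smooth_on (E := R^o) `[0, 1] gamma, gamma 0 = a, gamma 1 = b &
        forall s : R, 0 <= s <= 1 -> K (gamma s)].

Definition time_reparametrization (R : realType) (tau : R -> R) : Prop :=
  [/\ smooth_on (E := R^o) (F := R^o) `[0, +oo[ tau,
      forall t : R, 0 <= t -> 0 <= tau t,
      {in `[0, +oo[ &, {homo tau : s t / s < t}} &
      tau t @[t --> +oo] --> +oo].

Definition hessian (R : realType) (n : nat) (g : 'rV[R]_n -> R)
    (p : 'rV[R]_n) : 'M[R]_n :=
  \matrix_(i, j) 'D_(delta_mx 0 i) ('D_(delta_mx 0 j) g) p.

Record finsler_metric (R : realType) (n : nat) (K : set 'rV[R]_n)
    (V : 'rV[R]_n -> 'rV[R]_n -> R) : Prop := {
  finsler_continuous :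
    {within K `*` setT, continuous (fun p => V p.1 p.2)} ;
  finsler_smooth :
    smooth_on (K `*` [set d | d != 0]) (fun p => V p.1 p.2) ;
  finsler_pos : forall x d : 'rV[R]_n, K x -> d != 0 -> 0 < V x d ;
  finsler_homogeneous : forall (x d : 'rV[R]_n) (c : R), K x -> 0 < c ->
    V x (c *: d) = c * V x d ;
  finsler_convex : forall x d v : 'rV[R]_n, K x -> d != 0 -> v != 0 ->
    0 < (v *m hessian (fun e => 2^-1 * V x e ^+ 2) d *m v^T) 0 0
}.

(* Main.v *)
Require Import Defs.
From mathcomp Require Import all_boot all_order all_algebra.
From mathcomp Require Import all_classical all_reals all_analysis.
From mathcomp Require Import ring lra.

Import Order.TTheory GRing.Theory Num.Theory.
Import numFieldNormedType.Exports.

Local Open Scope classical_set_scope.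
Local Open Scope ring_scope.

Set Implicit Arguments.
Unset Strict Implicit.
Unset Printing Implicit Defensive.

(** The two solutions share an asymptotic phase: there is a constant c with
    x1 t - x2 (t + c) --> 0. Being related by such a shift is an equivalence
    relation between orbits in K, so it is enough to find eps > 0 for which two
    orbits starting at distance less than eps are related: the path joining the
    two initial points is then cut into pieces shorter than eps.

    For two nearby orbits x and y, the quantity to follow is
    V (x t) (y u - x t), the Finsler length of a finite difference.
    Compactness of K turns the contraction inequality into one with a uniform
    margin, valid for all nearly transverse directions
    (uniform_transverse_contraction). The direction of y u - x t moves at
    bounded speed however short the vector is, so over a fixed time h a
    difference that starts nearly transverse stays so, and letting both orbits
    run for the time h multiplies V by a constant theta < 1 (contraction_step).

    Before each such run the time u on the second orbit is corrected to a
    minimum of V (x t) (y u - x t) on a window of size proportional to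
    |y u - x t|. At an interior minimum the derivative of V along f (y u)
    vanishes, and f (y u) is close to f (x t): this is approximate
    transversality (reminimization). The minimum is interior when f (x t) is
    not too small, since y then crosses the window at a definite speed. Where
    f (x t) is small every direction is nearly transverse and u is kept; in
    particular equilibria are covered by the same argument.

    The corrections of u are bounded by a multiple of theta ^+ k at step k, so
    the shift u - t converges geometrically to the phase c (local_phase).

    The shift is finally made into a reparametrization by
    tau t = t + c - c * expR (- k * t), with k so small that tau increases. *)

(** * Calculus along curves *)

Lemma coord_le_norm (R : realType) (n : nat) (v : 'rV[R]_n) (i : 'I_n) :
  `|v 0 i| <= `|v|.
Proof.
rewrite [leRHS]/Num.Def.normr/= mx_normrE.
exact: (le_bigmax _ (fun ij => `|v ij.1 ij.2|) (0, i)).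
Qed.

Lemma norm_le_coord (R : realType) (n : nat) (v : 'rV[R]_n) (B : R) :
  0 <= B -> (forall i, `|v 0 i| <= B) -> `|v| <= B.
Proof.
move=> B0 vB; rewrite [leLHS]/Num.Def.normr/= mx_normrE.
by apply: bigmax_le => // -[i j] _; rewrite (ord1 i).
Qed.

Lemma is_derive_coord (R : realType) (n : nat) (g : R -> 'rV[R]_n) (t : R)
    (v : 'rV[R]_n) (i : 'I_n) :
  is_derive t 1 g v -> is_derive t 1 (fun s => g s 0 i) (v 0 i).
Proof.
move=> [dg <-]; split; first exact: (derivable_mxP _ _ _).1.
by rewrite derive_mx// mxE.
Qed.

Lemma continuous_within_comp (T U W : topologicalType) (A : set T)
    (g : T -> U) (h : U -> W) :
  {within A, continuous g} -> continuous h -> {within A, continuous (h \o g)}.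
Proof.
by move=> cg ch x; apply: cvg_comp (cg x) (ch (g x)).
Qed.

(** For the maximum norm the scalar mean value theorem applied to each
    coordinate gives the vector inequality without loss. *)
Lemma mvt_norm (R : realType) (n : nat) (g dg : R -> 'rV[R]_n) (a b B : R) :
  a <= b -> {within `[a, b], continuous g} ->
  (forall t, a < t < b -> is_derive t 1 g (dg t)) ->
  (forall t, a < t < b -> `|dg t| <= B) ->
  `|g b - g a| <= B * (b - a).
Proof.
rewrite le_eqVlt => /predU1P[-> _ _ _|ab cg dgE dgB].
  by rewrite !subrr normr0 mulr0.
have B0 : 0 <= B.
  by apply: le_trans (dgB ((a + b) / 2) _) => //; lra.
apply: norm_le_coord => [|i]; first by rewrite mulr_ge0// subr_ge0 ltW.
rewrite !mxE.
have [||c cab ->] := @MVT R (fun s => g s 0 i) (fun s => dg s 0 i) a b ab.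
- by move=> x; rewrite in_itv/= => xab; exact/is_derive_coord/dgE.
- exact: (@continuous_within_comp _ _ _ _ _ (fun M : 'rV[R]_n => M 0 i) cg
    (@coord_continuous _ _ _ _ _)).
- have ba : 0 <= b - a by rewrite subr_ge0 ltW.
  rewrite normrM (ger0_norm ba) ler_wpM2r//=.
  by apply: le_trans (coord_le_norm _ _) _; apply: dgB; rewrite in_itv/= in cab.
Qed.

Lemma is_derive_chain (R : realType) (E F : normedModType R) (G : E -> F)
    (p : R -> E) (t : R) (v : E) :
  differentiable G (p t) -> is_derive t 1 p v ->
  is_derive t 1 (G \o p) ('d G (p t) v).
Proof.
move=> dG [/derivable1_diffP dp <-].
split; first exact/derivable1_diffP/differentiable_comp.
rewrite deriveE; last exact: differentiable_comp.
by rewrite diff_comp// deriveE.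
Qed.

Lemma is_derive_pair (R : realType) (E F : normedModType R) (p : R -> E)
    (q : R -> F) (t : R) (v : E) (w : F) :
  is_derive t 1 p v -> is_derive t 1 q w ->
  is_derive t 1 (fun s => (p s, q s)) (v, w).
Proof.
move=> [/derivable1_diffP dp <-] [/derivable1_diffP dq <-].
split; first exact/derivable1_diffP/differentiable_pair.
rewrite deriveE; last exact: differentiable_pair.
by rewrite diff_pair// !deriveE.
Qed.

Lemma is_derive_translate (R : realType) (E : normedModType R) (p : R -> E)
    (t s : R) (v : E) :
  is_derive (t + s) 1 p v -> is_derive s 1 (fun r => p (t + r)) v.
Proof.
move=> [/derivable1_diffP dp <-].
have -> : (fun r => p (t + r)) = p \o shift t.
  by apply/funext => r; rewrite /= addrC.
rewrite addrC in dp *.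
have := @is_derive_chain R R^o E p _ s _ dp (is_derive_shift _ _ _).
by rewrite deriveE.
Qed.

Lemma smooth_on_differentiable (R : realType) (E F : normedModType R)
    (A : set E) (g : E -> F) (x : E) :
  smooth_on A g -> A x -> differentiable g x.
Proof. by move=> [U [_ AU sU]] /AU /(sU [::]). Qed.

(** In finite dimension, continuity of the directional derivatives along the
    vectors of a basis makes the differential continuous jointly in the point
    and the direction. The frame b with coordinates k covers both spaces
    of row vectors and products of two of them. *)
Lemma continuous_diff_frame (R : realType) (E F : normedModType R)
    (I : finType) (b : I -> E) (k : I -> E -> R) (A : set E) (g : E -> F)
    (x v : E) :
  (forall i, continuous (k i)) -> (forall w, w = \sum_i k i w *: b i) ->
  smooth_on A g -> A x ->
  {for (x, v), continuous (fun z : E * E => 'd g (z.1) z.2)}.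
Proof.
move=> kc kE [U [oU AU sU]] /AU Ux.
have E1 z : U z.1 -> 'd g (z.1) z.2 = \sum_i k i z.2 *: 'D_(b i) g z.1.
  move=> /(sU [::]) dz; rewrite {1}(kE z.2) linear_sum.
  by apply: eq_bigr => i _; rewrite linearZ deriveE.
have E2 := E1 (x, v) Ux; rewrite /= in E2.
suff : (fun z : E * E => 'd g (z.1) z.2) @ (x, v) --> 'd g x v by [].
rewrite E2; apply: cvg_trans.
  apply: (@near_eq_cvg _ _ _ _
    (fun z : E * E => \sum_i k i z.2 *: 'D_(b i) g z.1) _).
  near=> z; apply/esym/E1; near: z.
  have : nbhs x U by exact: open_nbhs_nbhs.
  exact: (@cvg_fst _ _ _ _ (nbhs_filter v)).
apply: cvg_big => [|i _]; first exact: add_continuous.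
apply: cvgZ.
  apply: (@cvg_comp _ _ _ snd (k i) (nbhs (x, v)) (nbhs v)); last exact: kc.
  exact: cvg_snd.
have : {for x, continuous ('D_(b i) g)}.
  exact: differentiable_continuous (sU [:: b i] x Ux).
apply: (@cvg_comp _ _ _ fst ('D_(b i) g) (nbhs (x, v)) (nbhs x)).
exact: cvg_fst.
Unshelve. all: by end_near. Qed.

Lemma continuous_diff_rV (R : realType) (n : nat) (F : normedModType R)
    (A : set 'rV[R]_n) (g : 'rV[R]_n -> F) (x v : 'rV[R]_n) :
  smooth_on A g -> A x ->
  {for (x, v), continuous (fun z : 'rV[R]_n * 'rV[R]_n => 'd g (z.1) z.2)}.
Proof.
move=> sg Ax; apply: (@continuous_diff_frame R _ _ _
  (fun i => delta_mx 0 i) (fun i w => w 0 i)) sg Ax.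
- by move=> i; exact: coord_continuous.
- by move=> w; exact: row_sum_delta.
Qed.

Lemma continuous_diff_rV2 (R : realType) (n : nat) (F : normedModType R)
    (A : set ('rV[R]_n * 'rV[R]_n)%type) (g : 'rV[R]_n * 'rV[R]_n -> F)
    (x v : 'rV[R]_n * 'rV[R]_n) :
  smooth_on A g -> A x ->
  {for (x, v), continuous (fun z : ('rV[R]_n * 'rV[R]_n) *
    ('rV[R]_n * 'rV[R]_n) => 'd g (z.1) z.2)}.
Proof.
move=> sg Ax; apply: (@continuous_diff_frame R _ _ ('I_n + 'I_n)%type
  (fun i => match i with inl j => (delta_mx 0 j, 0) | inr j => (0, delta_mx 0 j)
            end)
  (fun i w => match i with inl j => w.1 0 j | inr j => w.2 0 j end)) sg Ax.
- case=> j w.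
    exact: (@continuous_comp _ _ _ _ (fun M : 'rV[R]_n => M 0 j) w
      cvg_fst (@coord_continuous _ _ _ _ _ _)).
  exact: (@continuous_comp _ _ _ _ (fun M : 'rV[R]_n => M 0 j) w
    cvg_snd (@coord_continuous _ _ _ _ _ _)).
- have fstS (h : 'I_n -> 'rV[R]_n * 'rV[R]_n) :
    (\sum_j h j).1 = \sum_j (h j).1 by exact: (big_morph fst).
  have sndS (h : 'I_n -> 'rV[R]_n * 'rV[R]_n) :
    (\sum_j h j).2 = \sum_j (h j).2 by exact: (big_morph snd).
  move=> w; rewrite big_sumType/=; apply: injective_projections.
    rewrite -[RHS]/((_ : 'rV[R]_n * 'rV[R]_n).1 + (_ : 'rV[R]_n * 'rV[R]_n).1).
    rewrite !fstS/= [X in _ + X]big1 ?addr0; first exact: row_sum_delta.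
    by move=> i _; rewrite scaler0.
  rewrite -[RHS]/((_ : 'rV[R]_n * 'rV[R]_n).2 + (_ : 'rV[R]_n * 'rV[R]_n).2).
  rewrite !sndS/= [X in X + _]big1 ?add0r; first exact: row_sum_delta.
  by move=> i _; rewrite scaler0.
Qed.

(** * Uniform estimates on a compact set *)

(** The form in which compactness is used: a property of a point and a radius
    that holds locally for all small radii holds for one common radius. *)
Lemma compact_common_radius (R : realType) (T : topologicalType) (A : set T)
    (P : R -> T -> Prop) :
  compact A ->
  (forall x, A x -> exists2 r0, 0 < r0 &
     \forall y \near x, forall r, 0 < r < r0 -> P r y) ->
  exists2 r, 0 < r & forall x, A x -> P r x.
Proof.
move=> /compact_near_coveringP cA loc.
have := cA R 0^'+ P _ _; case=> [x /loc[r0 r00 Pr0]|r r_gt0 rP].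
  exists ([set y | forall r, 0 < r < r0 -> P r y], [set r | 0 < r < r0]).
    by split=> //=; near=> r; apply/andP; split; near: r;
      [exact: nbhs_right_gt|exact: nbhs_right_lt].
  by move=> [y r] /= [Py]; exact: Py.
exists (r / 2); first by rewrite divr_gt0.
apply: rP; last by rewrite divr_gt0.
by rewrite /ball_/= sub0r normrN gtr0_norm ?divr_gt0//; rewrite /= in r_gt0; lra.
Unshelve. all: by end_near. Qed.

Lemma compact_norm_le (R : realType) (T : topologicalType)
    (W : normedModType R) (A : set T) (g : T -> W) :
  compact A -> (forall x, A x -> {for x, continuous g}) ->
  exists2 B, 0 < B & forall x, A x -> `|g x| <= B.
Proof.
move=> cA gc.
(* The radius stands for the inverse of the bound. *)
have [x Ax|r r0 rP] := @compact_common_radius R T A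
    (fun r x => r * `|g x| <= 1) cA.
  exists (`|g x| + 1)^-1; first by rewrite invr_gt0 ltr_wpDl.
  have : \forall y \near x, `|g y| < `|g x| + 1.
    have := (cvgr_norm_lt _ (gc x Ax) (`|g x| + 1)); apply; lra.
  apply: filterS => y yx r /andP[r0 rx].
  have gx0 : 0 < `|g x| + 1 by rewrite ltr_wpDl.
  rewrite -ler_pdivlMl// mulr1; apply/ltW/(lt_trans yx).
  by rewrite -[ltLHS]invrK ltf_pV2// posrE invr_gt0.
exists r^-1; first by rewrite invr_gt0.
by move=> x /rP; rewrite -ler_pdivlMl// mulr1.
Qed.

Lemma compact_gt0_ge (R : realType) (T : topologicalType) (A : set T)
    (g : T -> R) :
  compact A -> (forall x, A x -> {for x, continuous g}) ->
  (forall x, A x -> 0 < g x) ->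
  exists2 c, 0 < c & forall x, A x -> c <= g x.
Proof.
move=> cA gc g0; apply: (@compact_common_radius R T A (fun r x => r <= g x) cA).
move=> x Ax; exists (g x / 2); first by rewrite divr_gt0 ?g0.
have : \forall y \near x, g x / 2 < g y.
  by apply: (cvgr_gt _ (gc x Ax)); have := g0 x Ax; lra.
by apply: filterS => y yx r /andP[_ rx]; exact/ltW/(lt_trans rx).
Qed.

Lemma compact_unif_continuous (R : realType) (E W : normedModType R)
    (A : set E) (g : E -> W) (e : R) :
  compact A -> (forall x, A x -> {for x, continuous g}) -> 0 < e ->
  exists2 r, 0 < r &
    forall x, A x -> forall z, `|z - x| < r -> `|g z - g x| < e.
Proof.
move=> cA gc e0; apply: (@compact_common_radius R E A
  (fun r x => forall z, `|z - x| < r -> `|g z - g x| < e) cA) => x Ax.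
have : \forall y \near x, `|g x - g y| < e / 2.
  by move/cvgrPdist_lt : (gc x Ax); apply; rewrite divr_gt0.
move=> /nbhs_normP[d /= d0 dP]; exists (d / 2); first by rewrite divr_gt0.
apply/nbhs_normP; exists (d / 2) => /=; first by rewrite divr_gt0.
move=> y /= yx r /andP[r0 rd] z zy.
have gy : `|g x - g y| < e / 2 by apply: dP => /=; lra.
have gz : `|g x - g z| < e / 2.
  apply: dP => /=; rewrite -(subrK y x) -addrA.
  by rewrite (le_lt_trans (ler_normD _ _))// (distrC y z); lra.
rewrite -(subrK (g x) (g z)) -addrA (le_lt_trans (ler_normD _ _))//.
by rewrite (distrC (g z)); lra.
Qed.

(** An annulus rather than the unit sphere, because a displacement is rescaled
    by its initial length and its length then varies along the motion. *)
Lemma compact_annulus (R : realType) (n : nat) :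
  compact [set v : 'rV[R]_n | 1 / 2 <= `|v| <= 2].
Proof.
apply: bounded_closed_compact.
  by exists 2; split; [exact: num_real|] => r r2 v /= /andP[_]; lra.
have nc : continuous (fun v : 'rV[R]_n => `|v|) by exact: norm_continuous.
rewrite (_ : [set v | _] = (fun v : 'rV[R]_n => `|v|) @^-1` `[1 / 2, 2]).
  by apply: preimage_closed; [move=> ? _; exact: nc|exact: itv_closed].
by apply/seteqP; split => v /=; rewrite in_itv.
Qed.

Lemma normalize_annulus (R : realType) (n : nat) (v : 'rV[R]_n) :
  v != 0 -> 1 / 2 <= `| `|v|^-1 *: v | <= 2.
Proof.
move=> v0; rewrite normrZ normfV normr_id mulVf ?normr_eq0//; lra.
Qed.

Lemma linear_norm_le (R : realType) (n : nat) (W : normedModType R)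
    (L : 'rV[R]_n -> W) (B : R) :
  (forall a v, L (a *: v) = a *: L v) ->
  (forall v, 1 / 2 <= `|v| <= 2 -> `|L v| <= B) ->
  forall v, `|L v| <= B * `|v|.
Proof.
move=> LZ LB v; have [->|v0] := eqVneq v 0.
  by rewrite -(scale0r (0 : 'rV[R]_n)) LZ !scale0r !normr0 mulr0.
have := LB _ (normalize_annulus v0).
rewrite LZ normrZ normfV normr_id -ler_pdivlMl ?invr_gt0 ?normr_gt0//.
by rewrite invrK mulrC.
Qed.

Lemma is_derive_scalel (R : realType) (E : normedModType R) (v : E) (s : R) :
  is_derive s 1 (fun r : R => r *: v) v.
Proof.
have dv : differentiable (fun r : R => r *: v) s by [].
split; first exact: diff_derivable.
by rewrite deriveE// diff_val scale1r.
Qed.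

(** On a compact set a smooth map is differentiable uniformly: the difference
    of the two sides, divided by |y - x|, is controlled by the oscillation of
    the differential over directions in the annulus. *)
Lemma compact_unif_differentiable (R : realType) (n : nat)
    (m : nat) (K : set 'rV[R]_n) (f : 'rV[R]_n -> 'rV[R]_m)
    (e : R) :
  compact K -> smooth_on K f -> 0 < e ->
  exists2 r, 0 < r & forall x, K x -> forall y, `|y - x| < r ->
    `|f y - f x - 'd f x (y - x)| <= e * `|y - x|.
Proof.
move=> cK sf e0.
have [U [oU KU sU]] := sf.
have [x Kx|r1 r10 dfr] := @compact_common_radius R _ K
    (fun r x => forall z, `|z - x| < r -> differentiable f z) cK.
  have : nbhs x U by exact/open_nbhs_nbhs/(conj oU)/KU.
  move=> /nbhs_normP[d /= d0 dP]; exists (d / 2); first by rewrite divr_gt0.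
  apply/nbhs_normP; exists (d / 2) => /=; first by rewrite divr_gt0.
  move=> y /= yx r /andP[r0 rd] z zy; apply: (sU [::]); apply: dP => /=.
  rewrite -(subrK y x) -addrA.
  by rewrite (le_lt_trans (ler_normD _ _))// (distrC y z); lra.
have [p [Kp _]|r2 r20 d2] := @compact_unif_continuous R
    ('rV[R]_n * 'rV[R]_n)%type _
    (K `*` [set v : 'rV[R]_n | 1 / 2 <= `|v| <= 2])
    (fun p => 'd f (p.1) p.2) e (compact_setX cK (@compact_annulus R n)) _ e0.
  by case: p Kp => p v /= Kp; exact: continuous_diff_rV sf Kp.
exists (Num.min r1 r2) => [|x Kx y]; first by rewrite lt_min r10.
rewrite lt_min => /andP[yr1 yr2].
have dd z : `|z - x| < r2 -> forall v, `|'d f z v - 'd f x v| <= e * `|v|.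
  move=> zx; apply: (@linear_norm_le _ _ _
    (fun v => 'd f z v - 'd f x v)) => [a v|v va].
    by rewrite scalerBr; congr (_ - _); exact: linearZ.
  have := d2 (x, v) (conj Kx va) (z, v); rewrite /= => H; apply/ltW/H.
  by rewrite prod_normE/= subrr normr0 gt_max zx.
set w := y - x in yr1 yr2 *.
have zE (s : R) : x + s *: w - x = s *: w by rewrite addrC addKr.
have zw (s : R) : 0 <= s <= 1 -> `|x + s *: w - x| <= `|w|.
  by move=> /andP[s0 s1]; rewrite zE normrZ ger0_norm// ler_piMl.
(* The segment from x to y may leave K but stays where f is differentiable. *)
pose g (s : R) : 'rV[R]_m := f (x + s *: w) - s *: 'd f x w.
have dg (s : R) : 0 <= s <= 1 ->
    is_derive s 1 g ('d f (x + s *: w) w - 'd f x w).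
  move=> s01; apply: is_deriveB; last exact: is_derive_scalel.
  apply: (@is_derive_chain R _ _ f (fun s => x + s *: w)).
    by apply: (dfr x Kx); exact: le_lt_trans (zw s s01) yr1.
  rewrite -[X in is_derive _ _ _ X]add0r.
  by apply: is_deriveD; exact: is_derive_scalel.
have -> : f y - f x - 'd f x w = g 1 - g 0.
  have xw : x + w = y by rewrite /w addrC subrK.
  by rewrite /g !scale1r !scale0r subr0 addr0 xw addrAC.
rewrite -[leRHS]mulr1 -[X in _ * X](subr0 1).
apply: (@mvt_norm R m g _ 0 1 _ ler01).
- apply: derivable_within_continuous => s; rewrite in_itv/= => s01.
  by have [] := dg s s01.
- by move=> s /andP[s0 s1]; apply: dg; rewrite !ltW.
- move=> s /andP[s0 s1]; apply: dd; apply: le_lt_trans yr2.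
  by apply: zw; rewrite !ltW.
Qed.

(** As K need not be convex, points at distance less than r are compared by
    uniform differentiability, and the others by the bound on f. *)
Lemma compact_lipschitz (R : realType) (n m : nat) (K : set 'rV[R]_n)
    (f : 'rV[R]_n -> 'rV[R]_m) :
  compact K -> smooth_on K f ->
  exists2 L, 0 < L & forall x y, K x -> K y -> `|f y - f x| <= L * `|y - x|.
Proof.
move=> cK sf.
have [r r0 fr] := compact_unif_differentiable cK sf ltr01.
have [p [Kp _]|C C0 dC] := @compact_norm_le R _ _
    (K `*` [set v : 'rV[R]_n | 1 / 2 <= `|v| <= 2])
    (fun p => 'd f (p.1) p.2) (compact_setX cK (@compact_annulus R n)).
  by case: p Kp => p v /= Kp; exact: continuous_diff_rV sf Kp.
have [x Kx|M M0 fM] := compact_norm_le cK (g := f).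
  exact/differentiable_continuous/(smooth_on_differentiable sf).
exists (1 + C + (M + M) / r) => [|x y Kx Ky].
  by rewrite !addr_gt0// divr_gt0// addr_gt0.
have [yr|yr] := ltP `|y - x| r.
  have h1 := fr x Kx y yr.
  have h2 : `|'d f x (y - x)| <= C * `|y - x|.
    apply: (@linear_norm_le _ _ _ ('d f x)) => [a v|v va]; first exact: linearZ.
    exact: (dC (x, v)).
  have h3 : 0 <= (M + M) / r * `|y - x|.
    by rewrite mulr_ge0// divr_ge0 ?addr_ge0// ltW.
  rewrite -(subrK ('d f x (y - x)) (f y - f x)) (le_trans (ler_normD _ _))//.
  by rewrite 2!mulrDl; lra.
apply: (@le_trans _ _ (M + M)).
  by rewrite (le_trans (ler_normB _ _))// lerD// fM.
rewrite mulrDl -[leLHS]add0r lerD//.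
  by rewrite mulr_ge0// addr_ge0// ltW.
by rewrite -mulrA ler_peMr ?addr_ge0 ?(ltW M0)// mulrC ler_pdivlMr ?mul1r.
Qed.

(** * Bounds on the Finsler function *)

Lemma continuous_for_pair (T U W : topologicalType) (p : T -> U) (q : T -> W)
    (t : T) :
  {for t, continuous p} -> {for t, continuous q} ->
  {for t, continuous (fun s => (p s, q s))}.
Proof. by move=> pc qc; exact: (cvg_pair pc qc). Qed.

Lemma continuous_for_comp (T U W : topologicalType) (p : T -> U) (g : U -> W)
    (t : T) :
  {for t, continuous p} -> {for p t, continuous g} ->
  {for t, continuous (fun s => g (p s))}.
Proof. by move=> pc gc; exact: (continuous_comp pc gc). Qed.

Section FinslerBounds.
Context {R : realType} {n : nat} {K : set 'rV[R]_n} {f : 'rV[R]_n -> 'rV[R]_n}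
  {lambda : R} {V : 'rV[R]_n -> 'rV[R]_n -> R}.
Hypotheses (f_smooth : smooth_on K f) (K_compact : compact K)
  (V_finsler : finsler_metric K V).

Local Notation G := (fun p : 'rV[R]_n * 'rV[R]_n => V p.1 p.2).
Local Notation annulus := [set v : 'rV[R]_n | 1 / 2 <= `|v| <= 2].

Let compact_KA : compact (K `*` annulus) :=
  compact_setX K_compact (@compact_annulus R n).

Lemma annulus_neq0 (v : 'rV[R]_n) : annulus v -> v != 0.
Proof. by move=> /= /andP[v2 _]; rewrite -normr_gt0; lra. Qed.

Lemma finsler_differentiable (x d : 'rV[R]_n) :
  K x -> d != 0 -> differentiable G (x, d).
Proof.
by move=> Kx d0; exact: smooth_on_differentiable (finsler_smooth V_finsler) _.
Qed.

Lemma finsler_annulus_continuous (p : 'rV[R]_n * 'rV[R]_n) :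
  (K `*` annulus) p -> {for p, continuous G}.
Proof.
case: p => x d [/= Kx Ad]; apply: differentiable_continuous.
exact/finsler_differentiable/annulus_neq0.
Qed.

Lemma finsler_normalize (x d : 'rV[R]_n) :
  K x -> d != 0 -> V x d = `|d| * V x (`|d|^-1 *: d).
Proof.
move=> Kx d0; rewrite -(finsler_homogeneous V_finsler)// ?normr_gt0//.
by rewrite scalerA divff ?normr_eq0// scale1r.
Qed.

Lemma finsler_ge_norm : exists2 c1, 0 < c1 &
  forall x d, K x -> d != 0 -> c1 * `|d| <= V x d.
Proof.
have [p [Kp Ap]|c c0 cP] := compact_gt0_ge compact_KA finsler_annulus_continuous.
  exact/(finsler_pos V_finsler)/annulus_neq0.
exists c => // x d Kx d0; rewrite finsler_normalize// mulrC ler_wpM2l//.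
by apply: (cP (x, _)); split=> //; exact: normalize_annulus.
Qed.

Lemma finsler_le_norm : exists2 c2, 0 < c2 &
  forall x d, K x -> d != 0 -> V x d <= c2 * `|d|.
Proof.
have [c c0 cP] := compact_norm_le compact_KA finsler_annulus_continuous.
exists c => // x d Kx d0; rewrite finsler_normalize// [leRHS]mulrC ler_wpM2l//.
apply: le_trans (ler_norm _) _.
by apply: (cP (x, _)); split=> //; exact: normalize_annulus.
Qed.

Lemma diff_finsler_continuous (T : topologicalType)
    (p w : T -> 'rV[R]_n * 'rV[R]_n) (t : T) :
  (K `*` annulus) (p t) -> {for t, continuous p} -> {for t, continuous w} ->
  {for t, continuous (fun s => 'd G (p s) (w s))}.
Proof.
move=> [Kp Ap] pc wc.
have Gc := @continuous_diff_rV2 R n R^o _ _ (p t) (w t)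
  (finsler_smooth V_finsler) (conj Kp (annulus_neq0 Ap)).
exact: (continuous_for_comp (continuous_for_pair pc wc) Gc).
Qed.

Lemma continuous_field (x : 'rV[R]_n) : K x -> {for x, continuous f}.
Proof.
by move=> Kx; exact/differentiable_continuous/(smooth_on_differentiable f_smooth).
Qed.

(** The left-hand side of the transversality condition, for p = (x, d). *)
Definition flow_slope (p : 'rV[R]_n * 'rV[R]_n) : R := 'd G p (0, f p.1).

Lemma flow_slope_continuous (p : 'rV[R]_n * 'rV[R]_n) :
  (K `*` annulus) p -> {for p, continuous flow_slope}.
Proof.
move=> Ap; apply: (@diff_finsler_continuous _ id (fun q => (0, f q.1)) p Ap).
  exact: cvg_id.
apply: continuous_for_pair; first exact: cst_continuous.
by apply: continuous_for_comp cvg_fst _; apply: continuous_field; case: Ap.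
Qed.

Lemma fibre_derivative_le : exists2 C, 0 < C & forall x d v, K x -> annulus d ->
  `|'d G (x, d) (0, v)| <= C * `|v|.
Proof.
have [q [KAq _]|C C0 CP] := @compact_norm_le R _ R^o _
    (fun q : ('rV[R]_n * 'rV[R]_n) * 'rV[R]_n => 'd G (q.1) (0, q.2))
    (compact_setX compact_KA (@compact_annulus R n)).
  apply: (@diff_finsler_continuous _ fst (fun q => (0, q.2)) q KAq).
    exact: cvg_fst.
  by apply: continuous_for_pair; [exact: cst_continuous|exact: cvg_snd].
exists C => // x d v Kx Ad.
apply: (@linear_norm_le _ _ R^o (fun w => 'd G (x, d) (0, w))) => [a w|w Aw].
  by rewrite -linearZ; congr ('d G (x, d) (_, _)); rewrite scaler0.
exact: (CP ((x, d), w)).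
Qed.

Hypotheses (lambda_gt0 : 0 < lambda)
  (V_contracting : forall x d : 'rV[R]_n, K x -> d != 0 ->
     'd (fun e : 'rV[R]_n => V x e) d (f x) = 0 ->
     'd (fun y : 'rV[R]_n => V y d) x (f x)
       + 'd (fun e : 'rV[R]_n => V x e) d (d *m 'J f x)
     <= - lambda * V x d).

(** The left-hand side of the contraction inequality: the derivative of V along
    the flow on tangent vectors. *)
Definition linearized_rate (p : 'rV[R]_n * 'rV[R]_n) : R :=
  'd G p (f p.1, 'd f (p.1) p.2).

Lemma linearized_rate_continuous (p : 'rV[R]_n * 'rV[R]_n) :
  (K `*` annulus) p -> {for p, continuous linearized_rate}.
Proof.
move=> Ap; apply: (@diff_finsler_continuous _ id
  (fun q => (f q.1, 'd f (q.1) q.2)) p Ap); first exact: cvg_id.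
apply: continuous_for_pair.
  by apply: continuous_for_comp cvg_fst _; apply: continuous_field; case: Ap.
case: p Ap => x d [Kx _].
exact: continuous_diff_rV f_smooth Kx.
Qed.

Lemma linearized_rate_lt0 (p : 'rV[R]_n * 'rV[R]_n) :
  (K `*` annulus) p -> flow_slope p = 0 -> linearized_rate p < 0.
Proof.
case: p => x d [/= Kx /annulus_neq0 d0] slope0.
have dG := finsler_differentiable Kx d0.
have fibre v : 'd (fun e : 'rV[R]_n => V x e) d v = 'd G (x, d) (0, v).
  have [dp dpE] : is_diff d (fun e : 'rV[R]_n => (cst x e, id e))
      (fun e => (0, e)) by exact: is_diff_pair.
  have := @diff_comp _ _ _ R^o _ G d dp dG.
  by rewrite dpE => /(congr1 (fun h : 'rV[R]_n -> R => h v)).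
have base v : 'd (fun y : 'rV[R]_n => V y d) x v = 'd G (x, d) (v, 0).
  have [dp dpE] : is_diff x (fun y : 'rV[R]_n => (id y, cst d y))
      (fun y => (y, 0)) by exact: is_diff_pair.
  have := @diff_comp _ _ _ R^o _ G x dp dG.
  by rewrite dpE => /(congr1 (fun h : 'rV[R]_n -> R => h v)).
have VL := V_contracting Kx d0 (etrans (fibre (f x)) slope0).
have rateE : linearized_rate (x, d) =
    'd G (x, d) (f x, 0) + 'd G (x, d) (0, d *m 'J f x).
  rewrite -(linearD ('d G (x, d))); congr ('d G (x, d) (_, _)).
    exact/esym/addr0.
  by rewrite /jacobian mul_rV_lin1 add0r.
apply: (@le_lt_trans _ _ (- lambda * V x d)).
  apply: le_trans VL; rewrite le_eqVlt; apply/orP; left; apply/eqP.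
  by apply: (etrans rateE); congr (_ + _); [exact/esym/base|exact/esym/fibre].
by rewrite mulNr oppr_lt0 mulr_gt0// (finsler_pos V_finsler).
Qed.

(** Near a transverse direction the rate stays below half of its negative
    value; near any other direction the slope stays away from 0, and for small
    eta there is nothing to prove. Compactness makes both alternatives
    uniform. *)
Lemma uniform_transverse_contraction : exists eta beta, [/\ 0 < eta, 0 < beta &
  forall p, (K `*` annulus) p -> `|flow_slope p| <= eta ->
    linearized_rate p <= - (2 * beta)].
Proof.
have [p Ap|r r0 rP] := @compact_common_radius R _ (K `*` annulus)
  (fun r p => `|flow_slope p| <= r -> linearized_rate p <= - (2 * r)) compact_KA.
  have [slope0|slope0] := eqVneq (flow_slope p) 0.
    have rate0 := linearized_rate_lt0 Ap slope0.
    exists (- linearized_rate p / 4); first by rewrite divr_gt0// oppr_gt0.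
    have : \forall q \near p, linearized_rate q < linearized_rate p / 2.
      by apply: (cvgr_lt _ (linearized_rate_continuous Ap)); lra.
    by apply: filterS => q qp r /andP[r0 rr] _; lra.
  exists (`|flow_slope p| / 2); first by rewrite divr_gt0// normr_gt0.
  have : \forall q \near p, `|flow_slope p| / 2 < `|flow_slope q|.
    apply: (cvgr_norm_gt _ (flow_slope_continuous Ap)).
    by move: slope0; rewrite -normr_gt0; lra.
  by apply: filterS => q qp r /andP[r0 rr]; lra.
by exists r, r.
Qed.

End FinslerBounds.

(** * Orbits in K *)

Definition orbit_in (R : realType) (n : nat) (K : set 'rV[R]_n)
    (f : 'rV[R]_n -> 'rV[R]_n) (x : R -> 'rV[R]_n) : Prop :=
  is_solution f x /\ forall t, 0 <= t -> K (x t).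

Section Orbits.
Context {R : realType} {n : nat} {K : set 'rV[R]_n} {f : 'rV[R]_n -> 'rV[R]_n}.
Implicit Types x y : R -> 'rV[R]_n.

Lemma solution_orbit_in x :
  strictly_forward_invariant K f -> is_solution f x -> K (x 0) -> orbit_in K f x.
Proof.
move=> inv sx Kx0; split=> // t; rewrite le_eqVlt => /predU1P[<-//|t0].
by apply: interior_subset; exact: inv.
Qed.

Lemma orbit_in_shift x (t : R) :
  0 <= t -> orbit_in K f x -> orbit_in K f (fun s => x (t + s)).
Proof.
rewrite le_eqVlt => /predU1P[<-|t0] [[xc xd] Kx].
  by rewrite (_ : (fun s => x (0 + s)) = x)//; apply/funext => s; rewrite add0r.
split=> [|s s0]; last by apply/Kx/addr_ge0 => //; exact: ltW.
have d (s : R) : 0 <= s -> is_derive s 1 (fun r => x (t + r)) (f (x (t + s))).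
  by move=> s0; apply/is_derive_translate/xd; rewrite ltr_wpDr.
split=> [|s s0]; last by apply: d; exact: ltW.
by apply: derivable_within_continuous => s; rewrite in_itv/= andbT => /d[].
Qed.

Lemma orbit_within_continuous x (a b : R) :
  0 <= a -> orbit_in K f x -> {within `[a, b], continuous x}.
Proof.
move=> a0 [[xc _] _]; apply: continuous_subspaceW xc => s /=.
by rewrite !in_itv/= andbT => /andP[as_ _]; exact: le_trans as_.
Qed.

Lemma orbit_speed_le x (M s t : R) :
  (forall p, K p -> `|f p| <= M) -> orbit_in K f x -> 0 <= s <= t ->
  `|x t - x s| <= M * (t - s).
Proof.
move=> fM ox /andP[s0 st]; have [[_ xd] Kx] := ox.
apply: (@mvt_norm _ _ x (f \o x)) => //.
- exact: orbit_within_continuous ox.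
- by move=> r /andP[sr _]; apply: xd; exact: le_lt_trans sr.
- by move=> r /andP[sr _]; apply/fM/Kx/ltW; exact: le_lt_trans sr.
Qed.

(** If m is the largest value of |y - x| on [0, t], attained at time c, then m
    <= |y 0 - x 0| + L * c * m, and L * c <= 1 / 4 gives m <= 2 * |y 0 - x 0|.
    The right-hand side is proportional to |y 0 - x 0|, so the direction of y -
    x varies slowly however close the orbits are. *)
Lemma orbit_separation x y (L t : R) :
  0 < L -> (forall p q, K p -> K q -> `|f q - f p| <= L * `|q - p|) ->
  orbit_in K f x -> orbit_in K f y -> 0 <= t -> 4 * L * t <= 1 ->
  `|(y t - x t) - (y 0 - x 0)| <= 2 * L * t * `|y 0 - x 0|.
Proof.
move=> L0 fL ox oy t0 tL; have [[_ xd] Kx] := ox; have [[_ yd] Ky] := oy.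
pose e (s : R) := y s - x s.
have ec (b : R) : {within `[0, b], continuous e}.
  move=> s; apply: cvgB.
    exact: (@orbit_within_continuous y 0 b (lexx 0) oy s).
  exact: (@orbit_within_continuous x 0 b (lexx 0) ox s).
have ed (s : R) : 0 < s -> is_derive s 1 e (f (y s) - f (x s)).
  by move=> s0; apply: is_deriveB; [exact: yd|exact: xd].
have [|c] := @EVT_max R (fun s => `|e s|) 0 t t0.
  exact: (continuous_within_comp (ec t) (@norm_continuous _ _)).
rewrite in_itv/= => /andP[c0 ct] cmax.
have estep (s : R) : 0 <= s <= t -> `|e s - e 0| <= L * `|e c| * s.
  move=> /andP[s0 st]; rewrite -[X in _ * X]subr0.
  apply: (@mvt_norm R n e (fun s => f (y s) - f (x s))) => //.
  - by move=> r /andP[r0 _]; exact: ed.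
  - move=> r /andP[r0 rs]; apply: le_trans (fL _ _ _ _) _.
    + exact/Kx/ltW.
    + exact/Ky/ltW.
    + have := cmax r; rewrite in_itv/= (ltW r0) (ltW (lt_le_trans rs st)).
      by move=> /(_ isT) /ler_wpM2l; apply; exact: ltW.
have ec2 : `|e c| <= 2 * `|e 0|.
  have := estep c; rewrite c0 ct => /(_ isT) H.
  have H2 : `|e c| <= `|e 0| + `|e c - e 0|.
    by rewrite -[X in `|X| <= _](subrK (e 0)) addrC ler_normD.
  have H3 : L * c <= 1 / 4 by have := ler_wpM2l (ltW L0) ct; lra.
  have := ler_wpM2l (normr_ge0 (e c)) H3; rewrite mulrCA mulrA => H4.
  by have := normr_ge0 (e 0); lra.
have := estep t; rewrite t0 lexx => /(_ isT) /le_trans; apply.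
have := ler_wpM2l (mulr_ge0 (ltW L0) t0) ec2; rewrite /e; lra.
Qed.

End Orbits.

(** * One step of contraction *)

Section Steps.
Context {R : realType} {n : nat} {K : set 'rV[R]_n} {f : 'rV[R]_n -> 'rV[R]_n}
  {lambda : R} {V : 'rV[R]_n -> 'rV[R]_n -> R}.
Hypotheses (f_smooth : smooth_on K f) (K_compact : compact K)
  (V_finsler : finsler_metric K V).
Implicit Types x y : R -> 'rV[R]_n.

Local Notation G := (fun p : 'rV[R]_n * 'rV[R]_n => V p.1 p.2).
Local Notation unit_slope a d := (flow_slope (f := f) (V := V) (a, `|d|^-1 *: d)).

(** The displacement y - x is divided by its initial length, which is constant
    in time: by homogeneity this only rescales V, and it keeps the displacement
    in the annulus, where the estimates are uniform. Its derivative is 'd f of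
    itself up to an error controlled by the uniform differentiability of f, so
    V decreases at a rate at least beta as long as the slope is at most eta;
    this lasts for the time h if the slope starts below eta / 2. *)
Lemma contraction_step (h0 : R) :
  0 < lambda ->
  (forall x d : 'rV[R]_n, K x -> d != 0 ->
     'd (fun e : 'rV[R]_n => V x e) d (f x) = 0 ->
     'd (fun y : 'rV[R]_n => V y d) x (f x)
       + 'd (fun e : 'rV[R]_n => V x e) d (d *m 'J f x)
     <= - lambda * V x d) ->
  0 < h0 ->
  exists eta h theta rho : R,
    [/\ 0 < eta, 0 < h <= h0, 0 < theta < 1, 0 < rho &
    forall x y, orbit_in K f x -> orbit_in K f y -> y 0 - x 0 != 0 ->
      `|y 0 - x 0| < rho -> `|unit_slope (x 0) (y 0 - x 0)| <= eta ->
      V (x h) (y h - x h) <= theta * V (x 0) (y 0 - x 0)].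
Proof.
move=> lambda_gt0 contr h0_gt0.
have [L L0 fL] := compact_lipschitz K_compact f_smooth.
have [M M0 fM] := compact_norm_le K_compact (continuous_field f_smooth).
have [c2 c20 Vc2] := finsler_le_norm K_compact V_finsler.
have [C C0 GC] := fibre_derivative_le K_compact V_finsler.
have [eta [beta [eta0 beta0 rate]]] :=
  uniform_transverse_contraction f_smooth K_compact V_finsler lambda_gt0 contr.
have e0 : 0 < beta / (2 * C) by rewrite divr_gt0// mulr_gt0.
have [r r0 fr] := compact_unif_differentiable K_compact f_smooth e0.
have eta20 : 0 < eta / 2 by rewrite divr_gt0.
have [delta delta0 slopeU] := compact_unif_continuous
  (compact_setX K_compact (@compact_annulus R n))
  (flow_slope_continuous f_smooth V_finsler) eta20.
(* The three terms make h at most h0, give 4 * L * h <= 1, and keep the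
   displacement of (x, q) over the time h below delta. *)
pose D := h0^-1 + 4 * L + (M + 2 * L) * 2 / delta.
have D1 : 0 < h0^-1 by rewrite invr_gt0.
have D2 : 0 < (M + 2 * L) * 2 / delta.
  by rewrite divr_gt0// mulr_gt0// addr_gt0// mulr_gt0.
have D0 : 0 < D by rewrite /D; lra.
pose h := D^-1.
have h_gt0 : 0 < h by rewrite invr_gt0.
have hD : h * D = 1 by rewrite mulVf// gt_eqF.
have hh0 : h <= h0.
  by rewrite -[leRHS]invrK lef_pV2 ?posrE//; rewrite /D; lra.
have hL : 4 * L * h <= 1.
  by rewrite -[leRHS]hD [leRHS]mulrC ler_wpM2r ?(ltW h_gt0)//; rewrite /D; lra.
have hdelta : (M + 2 * L) * h < delta.
  have : h * ((M + 2 * L) * 2 / delta) <= 1.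
    by rewrite -[leRHS]hD ler_wpM2l ?(ltW h_gt0)//; rewrite /D; lra.
  rewrite mulrA ler_pdivrMr// mul1r => H.
  have : 0 < (M + 2 * L) * h by rewrite mulr_gt0// addr_gt0// mulr_gt0.
  lra.
(* V loses beta * h, which is at least kappa times its final value since V
   decreases from at most c2. *)
pose kappa := beta * h / c2.
have kappa0 : 0 < kappa by rewrite divr_gt0// mulr_gt0.
exists (eta / 2), h, (1 + kappa)^-1, (r / 2); split.
- by rewrite divr_gt0.
- by rewrite h_gt0.
- have kappa1 : 0 < 1 + kappa by rewrite addr_gt0.
  by rewrite invr_gt0 kappa1 invf_lt1// ltrDl.
- by rewrite divr_gt0.
move=> x y ox oy; pose E (s : R) := y s - x s.
rewrite -/(E 0) -/(E h) => E0 Er slope0.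
have [[_ xd] Kx] := ox; have [[_ yd] Ky] := oy.
have rho0 : 0 < `|E 0| by rewrite normr_gt0.
pose q (s : R) := `|E 0|^-1 *: E s.
have nq0 : `|q 0| = 1 by rewrite normrZ normfV normr_id mulVf// gt_eqF.
have qdist (s : R) : 0 <= s <= h -> `|q s - q 0| <= 2 * L * s.
  move=> /andP[s0 sh].
  rewrite -scalerBr normrZ normfV normr_id ler_pdivrMl// mulrC.
  apply: (orbit_separation L0 fL ox oy s0); apply: le_trans hL.
  by rewrite ler_wpM2l// mulr_ge0// ltW.
have qA (s : R) : 0 <= s <= h -> 1 / 2 <= `|q s| <= 2.
  move=> s0h; have /andP[s0 sh] := s0h.
  have H1 := qdist s s0h.
  have H2 : 2 * L * s <= 1 / 2.
    have : 4 * L * s <= 4 * L * h by rewrite ler_wpM2l// mulr_ge0// ltW.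
    lra.
  have H3 := lerB_dist (q 0) (q s); have H4 := lerB_dist (q s) (q 0).
  by move: H3 H4; rewrite (distrC (q 0)) nq0; lra.
have slope_s (s : R) : 0 <= s <= h ->
    `|flow_slope (f := f) (V := V) (x s, q s)| <= eta.
  move=> s0h; have /andP[s0 sh] := s0h.
  have := slopeU (x 0, q 0) (conj (Kx 0 (lexx 0)) (qA 0 _)) (x s, q s).
  rewrite lexx ltW// => /(_ isT) H.
  have : `|(x s, q s) - (x 0, q 0)| < delta.
    rewrite prod_normE/= gt_max; apply/andP; split.
      apply: (le_lt_trans (orbit_speed_le fM ox _)); first by rewrite lexx.
      rewrite subr0; apply: le_lt_trans hdelta.
      by rewrite ler_pM ?(ltW M0)//; lra.
    apply: (le_lt_trans (qdist s s0h)); apply: le_lt_trans hdelta.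
    by rewrite ler_pM ?mulr_ge0 ?(ltW L0)//; lra.
  move=> /H {}H.
  rewrite -(subrK (flow_slope (f := f) (V := V) (x 0, q 0))
    (flow_slope (x s, q s))).
  by apply: le_trans (ler_normD _ _) _; move: slope0; rewrite -/(q 0); lra.
have qd (s : R) : 0 < s ->
    is_derive s 1 q (`|E 0|^-1 *: (f (y s) - f (x s))).
  by move=> s0; apply/is_deriveZ/is_deriveB; [exact: yd|exact: xd].
pose v (s : R) := V (x s) (q s).
pose dv (s : R) := 'd G (x s, q s) (f (x s), `|E 0|^-1 *: (f (y s) - f (x s))).
have vd (s : R) : 0 < s < h -> is_derive s 1 v (dv s).
  move=> /andP[s0 sh].
  apply: (@is_derive_chain R _ R^o G (fun s => (x s, q s))).
    apply: (finsler_differentiable V_finsler); first exact/Kx/ltW.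
    by apply: annulus_neq0; apply: qA; rewrite !ltW.
  by apply: is_derive_pair; [exact: xd|exact: qd].
have dvB (s : R) : 0 < s < h -> dv s <= - beta.
  move=> /andP[s0 sh]; have s0h : 0 <= s <= h by rewrite !ltW.
  have Kxs := Kx s (ltW s0).
  pose w := `|E 0|^-1 *: (f (y s) - f (x s) - 'd f (x s) (E s)).
  have nEq : `|E s| = `|E 0| * `|q s|.
    by rewrite normrZ normfV normr_id mulrA divff ?mul1r// gt_eqF.
  have nw : `|w| <= beta / (2 * C) * 2.
    rewrite normrZ normfV normr_id ler_pdivrMl//.
    apply: (le_trans (fr _ Kxs (y s) _)).
      have /andP[_ q2] := qA s s0h; rewrite -/(E s) nEq.
      by have := ler_wpM2l (ltW rho0) q2; lra.
    have /andP[_ q2] := qA s s0h; rewrite -/(E s) nEq mulrCA.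
    rewrite ler_wpM2l ?(ltW rho0)// ler_wpM2l// divr_ge0 ?(ltW beta0)//.
    by rewrite mulr_ge0// ltW.
  have -> : dv s = linearized_rate (f := f) (V := V) (x s, q s)
                   + 'd G (x s, q s) (0, w).
    rewrite -(linearD ('d G (x s, q s))); congr ('d G (x s, q s) (_, _)).
      exact/esym/addr0.
    have dq : 'd f (x s) (q s) = `|E 0|^-1 *: 'd f (x s) (E s).
      exact: linearZ.
    have -> : w = `|E 0|^-1 *: (f (y s) - f (x s)) - 'd f (x s) (q s).
      by rewrite dq; exact: scalerBr.
    by rewrite [RHS]addrC subrK.
  have H1 := rate (x s, q s) (conj Kxs (qA s s0h)) (slope_s s s0h).
  have H2 := GC (x s) (q s) w Kxs (qA s s0h).
  have H3 : C * `|w| <= beta.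
    apply: le_trans (ler_wpM2l (ltW C0) nw) _.
    by rewrite le_eqVlt; apply/orP; left; apply/eqP; field; rewrite gt_eqF.
  by have := ler_norm ('d G (x s, q s) (0, w)); lra.
have vc : {within `[0, h], continuous v}.
  apply/subspace_continuousP => s /=; rewrite in_itv/= => s0h.
  have /andP[s0 sh] := s0h.
  have inh : `[0, h]%classic s by rewrite /= in_itv.
  have xc := @orbit_within_continuous _ _ _ _ x 0 h (lexx 0) ox.
  have yc := @orbit_within_continuous _ _ _ _ y 0 h (lexx 0) oy.
  move/subspace_continuousP : xc => /(_ s inh) xc.
  move/subspace_continuousP : yc => /(_ s inh) yc.
  have Gc : {for (x s, q s), continuous G}.
    apply: (finsler_annulus_continuous V_finsler).
    by split; [exact: Kx|exact: qA].
  have qc : q r @[r --> within `[0, h] (nbhs s)] --> q s.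
    by apply: cvgZ; [exact: cvg_cst|exact: cvgB].
  exact: (cvg_comp _ _ (cvg_pair xc qc) Gc).
have [c c0h vE] : exists2 c, c \in `]0, h[ & v h - v 0 = dv c * (h - 0).
  by apply: MVT vc => // s; rewrite in_itv/=; exact: vd.
have VE (s : R) : 0 <= s -> E s != 0 -> V (x s) (E s) = `|E 0| * v s.
  move=> s0 Es0; rewrite /v /q -(finsler_homogeneous V_finsler) ?normr_gt0//.
    by rewrite scalerA divff ?scale1r// gt_eqF.
  exact: Kx.
have Eh0 : E h != 0.
  have /andP[qh _] : 1 / 2 <= `|q h| <= 2 by apply: qA; rewrite lexx ltW.
  by apply: contraTneq qh => Eh0; rewrite /q Eh0 scaler0 normr0; lra.
rewrite VE ?(ltW h_gt0)// VE// mulrCA ler_wpM2l ?(ltW rho0)//.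
rewrite ler_pdivlMl; last by lra.
have v0c : v 0 <= c2.
  rewrite /v (le_trans (Vc2 _ _ (Kx 0 _) _))// ?nq0 ?mulr1//.
  by rewrite -normr_gt0 nq0.
move: vE; rewrite subr0 => vE.
have H1 : dv c * h <= - beta * h.
  by rewrite ler_wpM2r ?(ltW h_gt0)// dvB//; rewrite in_itv in c0h.
have H2 : kappa * v h <= beta * h.
  have -> : beta * h = kappa * c2 by rewrite /kappa; field; rewrite gt_eqF.
  rewrite ler_wpM2l ?(ltW kappa0)//.
  have : 0 < beta * h by rewrite mulr_gt0.
  lra.
lra.
Qed.

End Steps.

(** * Correction of the time on the second orbit *)

Section Reminimize.
Context {R : realType} {n : nat} {K : set 'rV[R]_n} {f : 'rV[R]_n -> 'rV[R]_n}
  {V : 'rV[R]_n -> 'rV[R]_n -> R}.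
Hypotheses (f_smooth : smooth_on K f) (K_compact : compact K)
  (V_finsler : finsler_metric K V).

Local Notation G := (fun p : 'rV[R]_n * 'rV[R]_n => V p.1 p.2).
Local Notation unit_slope a d := (flow_slope (f := f) (V := V) (a, `|d|^-1 *: d)).

(** If f a is small then the slope is small in every direction. Otherwise,
    close to a, the orbit y moves with velocity almost f a; at the ends of the
    window of half-width C * |y u - a| it is so far from a that V exceeds its
    value at u, and the minimum of V over the window is attained inside. *)
Lemma reminimization (eta : R) :
  0 < eta ->
  exists C rho : R, [/\ 0 < C, 0 < rho &
    forall (a : 'rV[R]_n) (y : R -> 'rV[R]_n) (u : R),
      K a -> orbit_in K f y -> y u - a != 0 -> `|y u - a| < rho ->
      C * `|y u - a| < u ->
      exists2 u', `|u' - u| <= C * `|y u - a| &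
        y u' = a \/
        V a (y u' - a) <= V a (y u - a) /\ `|unit_slope a (y u' - a)| <= eta].
Proof.
move=> eta0.
have [L L0 fL] := compact_lipschitz K_compact f_smooth.
have [M M0 fM] := compact_norm_le K_compact (continuous_field f_smooth).
have [c1 c10 Vc1] := finsler_ge_norm K_compact V_finsler.
have [c2 c20 Vc2] := finsler_le_norm K_compact V_finsler.
have [D D0 GD] := fibre_derivative_le K_compact V_finsler.
pose m := eta / D.
have m0 : 0 < m by rewrite divr_gt0.
have Dm : D * m = eta by rewrite /m mulrC divfK// gt_eqF.
(* The window is chosen so that y travels more than (c2 / c1 + 2) * |y u - a|
   from its middle to either end. *)
pose C := 2 * (c2 / c1 + 2) / m.
have cc0 : 0 < c2 / c1 by rewrite divr_gt0.
have C0 : 0 < C by rewrite divr_gt0// mulr_gt0//; lra.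
have Cm : C * m = 2 * (c2 / c1 + 2) by rewrite /C divfK// gt_eqF.
pose B := L * (1 + M * C).
have B0 : 0 < B by rewrite mulr_gt0// addr_gt0// mulr_gt0.
(* Within the window f (y v) is then at distance at most m / 2 from f a. *)
pose rho := m / (2 * B).
exists C, rho; split=> //; first by rewrite divr_gt0// mulr_gt0.
move=> a y u Ka oy e0 er Cu.
have [[_ yd] Ky] := oy.
set d := `|y u - a| in er Cu *.
have d0 : 0 < d by rewrite normr_gt0.
have [w wE] : exists w, w = C * d by exists (C * d).
rewrite -wE in Cu *.
have w0 : 0 < w by rewrite wE mulr_gt0.
have u0 : 0 < u by exact: lt_trans Cu.
have [fa_small|fa_large] := leP `|f a| m.
  exists u; first by rewrite subrr normr0 ltW.
  right; split=> //.
  apply: (le_trans (GD _ _ _ Ka (normalize_annulus e0))).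
  by rewrite -Dm ler_wpM2l// ltW.
have near_a (v : R) : u - w <= v <= u + w -> `|f (y v) - f a| <= m / 2.
  move=> /andP[v1 v2].
  have yv : `|y v - y u| <= M * w.
    have [uv|vu] := leP u v.
      apply: le_trans (orbit_speed_le fM oy _) _; first by rewrite uv andbT ltW.
      by rewrite ler_wpM2l ?(ltW M0)//; lra.
    rewrite distrC; apply: le_trans (orbit_speed_le fM oy _) _.
      by rewrite (ltW vu) andbT; lra.
    by rewrite ler_wpM2l ?(ltW M0)//; lra.
  apply: le_trans (fL _ _ Ka (Ky v _)) _; first by lra.
  have H1 : `|y v - a| <= M * w + d.
    rewrite -(subrK (y u) (y v)) -addrA.
    exact: le_trans (ler_normD _ _) (lerD yv (lexx _)).
  apply: (@le_trans _ _ (B * d)).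
    have := ler_wpM2l (ltW L0) H1; rewrite /B wE; lra.
  have : B * d <= B * rho by rewrite ler_wpM2l ?(ltW B0)// ltW.
  rewrite (_ : B * rho = m / 2)//; rewrite /rho; field; rewrite gt_eqF//.
have pos (v : R) : u - w <= v -> 0 < v by lra.
pose g (v : R) : 'rV[R]_n := y v - v *: f a.
have gdist (s t : R) : u - w <= s -> s <= t -> t <= u + w ->
    `|g t - g s| <= m / 2 * (t - s).
  move=> us st tu.
  have gd (r : R) : u - w <= r -> is_derive r 1 g (f (y r) - f a).
    move=> ur; apply: is_deriveB; last exact: is_derive_scalel.
    exact/yd/pos.
  apply: (@mvt_norm _ _ g (fun r => f (y r) - f a)) => //.
  - apply: derivable_within_continuous => r; rewrite in_itv/= => /andP[sr _].
    by have [] := gd r (le_trans us sr).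
  - by move=> r /andP[sr _]; apply: gd; exact/ltW/(le_lt_trans us).
  - move=> r /andP[sr rt]; apply: near_a; apply/andP; split.
      exact/ltW/(le_lt_trans us).
    exact/ltW/(lt_le_trans rt).
have far (s t : R) : u - w <= s -> s <= t -> t <= u + w -> t - s = w ->
    (c2 / c1 + 2) * d < `|y t - y s|.
  move=> us st tu tsw.
  have H1 := gdist s t us st tu.
  have H2 : (t - s) *: f a = (y t - y s) - (g t - g s).
    by rewrite /g scalerBl opprB addrA subrKA opprB [RHS]addrC subrKA.
  have H3 : (t - s) * `|f a| <= `|y t - y s| + `|g t - g s|.
    rewrite -[t - s in leLHS]ger0_norm ?subr_ge0// -normrZ H2.
    exact: ler_normB.
  rewrite tsw in H1 H3.
  have H4 : w * m < w * `|f a| by rewrite ltr_pM2l.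
  have H5 : w * m = 2 * (c2 / c1 + 2) * d by rewrite wE mulrAC Cm.
  lra.
have edge (v : R) : u - w <= v <= u + w -> y v != a -> 
    (c2 / c1 + 2) * d < `|y v - y u| -> V a (y u - a) < V a (y v - a).
  move=> uv yva yvu.
  have yva0 : y v - a != 0 by rewrite subr_eq0.
  apply: le_lt_trans (Vc2 _ _ Ka e0) _; rewrite -/d.
  apply: lt_le_trans (Vc1 _ _ Ka yva0).
  have H1 : `|y v - y u| <= `|y v - a| + d.
    by rewrite /d (distrC (y u)); exact: ler_distD.
  have : (c2 / c1 + 1) * d < `|y v - a| by lra.
  rewrite -(ltr_pM2l c10); apply: le_lt_trans.
  have -> : c1 * ((c2 / c1 + 1) * d) = c2 * d + c1 * d.
    by field; rewrite gt_eqF.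
  by rewrite lerDl mulr_ge0// ltW.
have [[v [uv yva]]|never] :=
    pselect (exists v, u - w <= v <= u + w /\ y v = a).
  exists v; last by left.
  by rewrite ler_norml; move: uv; lra.
have neva (v : R) : u - w <= v <= u + w -> y v - a != 0.
  move=> uv; rewrite subr_eq0; apply/eqP => yva.
  by apply: never; exists v.
pose phi (r v : R) := V a (r *: (y v - a)).
have phid (r v : R) : 0 < r -> u - w <= v <= u + w ->
    is_derive v 1 (phi r) ('d G (a, r *: (y v - a)) (0, r *: f (y v))).
  move=> r0 uv.
  apply: (@is_derive_chain R _ R^o G (fun v => (a, r *: (y v - a)))).
    apply: (finsler_differentiable V_finsler) => //.
    by rewrite scaler_eq0 gt_eqF//=; exact: neva.
  apply: is_derive_pair; apply: is_deriveZ; rewrite -[f (y v)]subr0.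
  apply: is_deriveB; apply: yd; apply: pos; by have /andP[] := uv.
have phic : {within `[u - w, u + w], continuous (phi 1)}.
  apply: derivable_within_continuous => v; rewrite in_itv/= => uv.
  by have [] := phid 1 v ltr01 uv.
have uw : u - w <= u + w by lra.
have [c] := EVT_min uw phic; rewrite in_itv/= => uc cmin.
have Vmin (v : R) : u - w <= v <= u + w -> V a (y c - a) <= V a (y v - a).
  by move=> uv; have := cmin v; rewrite in_itv/= /phi !scale1r; exact.
have uin : u - w <= u <= u + w by lra.
exists c; first by rewrite ler_norml; move: uc; lra.
right; split; first exact: Vmin.
have c_in : c \in `]u - w, u + w[.
  have /andP[uc1 uc2] := uc; rewrite in_itv/= !lt_neqAle uc1 uc2 !andbT.
  apply/andP; split; apply/eqP => cE.
    have := Vmin u uin; apply/negP; rewrite -ltNge; apply: edge => //.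
      by rewrite -subr_eq0; exact: neva.
    by rewrite distrC; apply: far; rewrite -?cE ?subKr ?gerBl ?lerDl// ltW.
  have := Vmin u uin; apply/negP; rewrite -ltNge; apply: edge => //.
    by rewrite -subr_eq0; exact: neva.
  by apply: far; rewrite ?cE ?gerBl ?lerDl ?(ltW w0)// addrC addKr.
(* The minimality of c is unaffected by the rescaling that makes the
   displacement a unit vector. *)
pose r := `|y c - a|^-1.
have r0 : 0 < r by rewrite invr_gt0 normr_gt0; exact: neva.
have crit : is_derive c 1 (phi r) 0.
  apply: (derive1_at_min uw _ c_in) => v; rewrite in_itv/= => /andP[v1 v2].
    by have [] := phid r v r0; rewrite ?ltW.
  rewrite /phi !(finsler_homogeneous V_finsler)//.
  by rewrite ler_pM2l//; apply: Vmin; rewrite !ltW.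
have slope0 : 'd G (a, r *: (y c - a)) (0, r *: f (y c)) = 0.
  by have [_ <-] := phid r c r0 uc; have [_ ->] := crit.
have slopeZ : 'd G (a, r *: (y c - a)) (0, r *: f (y c))
    = r *: ('d G (a, r *: (y c - a)) (0, f (y c)) : R^o).
  by rewrite -linearZ; congr ('d G (a, _) (_, _)); rewrite scaler0.
have slopeB : 'd G (a, r *: (y c - a)) (0, f (y c) - f a)
    = 'd G (a, r *: (y c - a)) (0, f (y c)) - 'd G (a, r *: (y c - a)) (0, f a).
  rewrite -(linearB ('d G (a, r *: (y c - a)))).
  by congr ('d G (a, _) (_, _)); rewrite subr0.
have slopeC : 'd G (a, r *: (y c - a)) (0, f (y c)) = 0.
  apply/eqP; have /eqP := etrans (esym slopeZ) slope0.
  by rewrite mulf_eq0 gt_eqF.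
have -> : unit_slope a (y c - a)
    = - 'd G (a, r *: (y c - a)) (0, f (y c) - f a).
  by apply/esym; rewrite slopeB slopeC sub0r opprK.
rewrite normrN; apply: (le_trans (GD _ _ _ Ka (normalize_annulus (neva c uc)))).
rewrite -Dm ler_wpM2l ?(ltW D0)//.
by apply: le_trans (near_a c uc) _; lra.
Qed.

End Reminimize.

(** * Asymptotic phase of nearby orbits *)

Definition phase_related (R : realType) (n : nat) (x y : R -> 'rV[R]_n) : Prop :=
  exists c : R, x t - y (t + c) @[t --> +oo] --> (0 : 'rV[R]_n).

(** The intervals of radius A * theta ^+ k around c_ k are nested. *)
Lemma geometric_limit (R : realType) (c_ : nat -> R) (A theta : R) :
  0 < A -> 0 < theta < 1 ->
  (forall k, `|c_ k.+1 - c_ k| <= A * (1 - theta) * theta ^+ k) ->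
  exists c, forall k, `|c - c_ k| <= A * theta ^+ k.
Proof.
move=> A0 /andP[th0 th1] cD.
pose l k := c_ k - A * theta ^+ k.
pose r k := c_ k + A * theta ^+ k.
have lm : nondecreasing_seq l.
  apply/nondecreasing_seqP => k.
  by have := cD k; rewrite ler_norml /l exprS => /andP[]; lra.
have rm : nonincreasing_seq r.
  apply/nonincreasing_seqP => k.
  by have := cD k; rewrite ler_norml /r exprS => /andP[]; lra.
have lr k m : l k <= r m.
  apply: le_trans (lm _ _ (leq_maxl k m)) _; apply: le_trans (rm _ _ (leq_maxr k m)).
  have : 0 < A * theta ^+ maxn k m by rewrite mulr_gt0// exprn_gt0.
  by rewrite /l /r; lra.
exists (sup (range l)) => k; rewrite ler_norml.
have ub : has_ubound (range l) by exists (r 0%N) => _ [m _ <-].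
have lsup : l k <= sup (range l) by apply: ub_le_sup => //; exists k.
have supr : sup (range l) <= r k.
  by apply: ge_sup; [exists (l 0%N), 0%N|move=> _ [m _ <-]].
by move: lsup supr; rewrite /l /r; lra.
Qed.

Lemma orbit_lipschitz (R : realType) (n : nat) (K : set 'rV[R]_n)
    (f : 'rV[R]_n -> 'rV[R]_n) (x : R -> 'rV[R]_n) (M s t : R) :
  (forall p, K p -> `|f p| <= M) -> orbit_in K f x -> 0 <= s -> 0 <= t ->
  `|x t - x s| <= M * `|t - s|.
Proof.
move=> fM ox s0 t0; have [st|ts] := leP s t.
  by rewrite ger0_norm ?subr_ge0// (orbit_speed_le fM)// s0.
rewrite distrC ler0_norm ?subr_le0 ?(ltW ts)// opprB.
by rewrite (orbit_speed_le fM)// t0 ltW.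
Qed.

(** Once the orbits meet, uniqueness makes one a time shift of the other. *)
Lemma meeting_phase (R : realType) (n : nat) (K : set 'rV[R]_n)
    (f : 'rV[R]_n -> 'rV[R]_n) (x y : R -> 'rV[R]_n) (t u : R) :
  solutions_unique K f -> orbit_in K f x -> orbit_in K f y ->
  0 <= t -> 0 <= u -> y u = x t -> phase_related x y.
Proof.
move=> uniq ox oy t0 u0 yx; exists (u - t).
have [sx Kx] := orbit_in_shift t0 ox; have [sy _] := orbit_in_shift u0 oy.
have E := uniq _ _ sx sy (Kx 0 (lexx 0)).
rewrite !addr0 in E; have {}E := E (esym yx).
apply: cvg_near_cst; near=> s.
have ts : t <= s by near: s; apply: nbhs_pinfty_ge; exact: num_real.
have := E (s - t); rewrite subr_ge0 => /(_ ts).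
rewrite addrC subrK => ->; apply/eqP; rewrite subr_eq0.
by apply/eqP; congr y; ring.
Unshelve. all: by end_near. Qed.

Section LocalPhase.
Context {R : realType} {n : nat} {K : set 'rV[R]_n} {f : 'rV[R]_n -> 'rV[R]_n}
  {lambda : R} {V : 'rV[R]_n -> 'rV[R]_n -> R}.
Hypotheses (f_smooth : smooth_on K f) (f_unique : solutions_unique K f)
  (K_compact : compact K) (lambda_gt0 : 0 < lambda) (V_finsler : finsler_metric K V)
  (V_contracting : forall x d : 'rV[R]_n, K x -> d != 0 ->
     'd (fun e : 'rV[R]_n => V x e) d (f x) = 0 ->
     'd (fun y : 'rV[R]_n => V y d) x (f x)
       + 'd (fun e : 'rV[R]_n => V x e) d (d *m 'J f x)
     <= - lambda * V x d).

(** At each time T k = (k + 1) * h the shift is corrected, then both orbits run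
    for the time h. The shift c_ k moves by at most A * (1 - theta) * theta ^+
    k, so it never exceeds A <= h / 4 and the windows stay within positive
    times. *)
Lemma local_phase : exists2 eps : R, 0 < eps &
  forall x y, orbit_in K f x -> orbit_in K f y -> `|y 0 - x 0| < eps ->
    phase_related x y.
Proof.
have [L L0 fL] := compact_lipschitz K_compact f_smooth.
have [M M0 fM] := compact_norm_le K_compact (continuous_field f_smooth).
have [c1 c10 Vc1] := finsler_ge_norm K_compact V_finsler.
have [c2 c20 Vc2] := finsler_le_norm K_compact V_finsler.
have L40 : 0 < 4 * L by rewrite mulr_gt0.
have L4 : 0 < (4 * L)^-1 by rewrite invr_gt0.
have [eta [h [theta [rhoA]]]] :=
  contraction_step f_smooth K_compact V_finsler lambda_gt0 V_contracting L4.
move=> [eta0 /andP[h0 hL] /andP[th0 th1] rhoA0 contr].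
have [C [rhoB [C0 rhoB0 remin]]] :=
  reminimization f_smooth K_compact V_finsler eta0.
have {}hL : 4 * L * h <= 1.
  by have := ler_wpM2l (ltW L40) hL; rewrite mulfV ?gt_eqF.
have th1' : 0 < 1 - theta by rewrite subr_gt0.
pose delta := Num.min (c1 * rhoA / 2)
  (Num.min (c1 * rhoB / 2) (c1 * (1 - theta) * h / (4 * C))).
have d0 : 0 < delta.
  by rewrite !lt_min !divr_gt0// !mulr_gt0.
have dA : delta <= c1 * rhoA / 2 by rewrite ge_min lexx.
have dB : delta <= c1 * rhoB / 2 by rewrite !ge_min lexx orbT.
have dC : delta <= c1 * (1 - theta) * h / (4 * C) by rewrite !ge_min lexx !orbT.
pose A := C * delta / (c1 * (1 - theta)).
have A0 : 0 < A by rewrite divr_gt0// mulr_gt0.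
have AE : A * (1 - theta) = C * delta / c1.
  by rewrite /A; field; rewrite !gt_eqF.
have Ah : A <= h / 4.
  rewrite /A ler_pdivrMr ?mulr_gt0//.
  move: dC; rewrite ler_pdivlMr ?mulr_gt0//; lra.
clearbody delta A.
exists (delta / (2 * c2)); first by rewrite divr_gt0// mulr_gt0.
move=> x y ox oy xy0.
have [[t [u [t0 u0 yx]]]|never] :=
    pselect (exists t u : R, [/\ 0 <= t, 0 <= u & y u = x t]).
  exact: meeting_phase f_unique ox oy t0 u0 yx.
have neq (t u : R) : 0 <= t -> 0 <= u -> y u - x t != 0.
  by move=> t0 u0; rewrite subr_eq0; apply/eqP => yx; apply: never; exists t, u.
have [[_ _] Kx] := ox; have [_ Ky] := oy.
pose T (k : nat) : R := k.+1%:R * h.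
have TS k : T k.+1 = T k + h by rewrite /T -natr1 mulrDl mul1r.
have Th k : h <= T k by rewrite /T ler_peMl ?(ltW h0)// ler1n.
have thk k : 0 < theta ^+ k <= 1 by rewrite exprn_gt0// exprn_ile1// ltW.
pose P k (c : R) := `|c| <= A * (1 - theta ^+ k) /\
  V (x (T k)) (y (T k + c) - x (T k)) <= delta * theta ^+ k.
have cA k c : P k c -> `|c| <= h / 4.
  move=> [cb _]; apply: le_trans cb _; apply: le_trans Ah.
  by rewrite ler_piMr ?(ltW A0)//; have := thk k; lra.
have uT k c : `|c| <= h / 4 -> 3 / 4 * h <= T k + c.
  by rewrite ler_norml => /andP[]; have := Th k; lra.
have enorm k c : P k c -> c1 * `|y (T k + c) - x (T k)| <= delta * theta ^+ k.
  move=> Pc; have [_] := Pc; apply: le_trans.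
  have u0 := uT k c (cA k c Pc).
  by apply: Vc1; [apply: Kx|apply: neq]; have := Th k; lra.
(* The first interval of length h only makes room for the windows; on it the
   distance at most doubles. *)
have P0 : P 0%N 0.
  split; first by rewrite normr0 expr0 subrr mulr0.
  rewrite expr0 mulr1 addr0 /T mul1r.
  apply: le_trans (Vc2 _ _ (Kx h (ltW h0)) (neq _ _ (ltW h0) (ltW h0))) _.
  have H1 := orbit_separation L0 fL ox oy (ltW h0) hL.
  have H2 : 2 * L * h * `|y 0 - x 0| <= `|y 0 - x 0|.
    by rewrite ler_piMl//; lra.
  have H3 : `|y h - x h| <= `|y 0 - x 0| + `|y h - x h - (y 0 - x 0)|.
    by rewrite -[X in `|X| <= _](subrK (y 0 - x 0)) addrC ler_normD.
  have H4 : c2 * `|y h - x h| <= c2 * (2 * `|y 0 - x 0|).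
    by rewrite ler_pM2l//; lra.
  apply: le_trans H4 _; move: xy0; rewrite ltr_pdivlMr ?mulr_gt0//; lra.
have Pstep k c : P k c -> exists c', P k.+1 c' /\
    `|c' - c| <= A * (1 - theta) * theta ^+ k.
  move=> Pc; have u34 := uT k c (cA k c Pc); have en := enorm k c Pc.
  have t0 : 0 <= T k by have := Th k; lra.
  have /andP[thk0 thk1] := thk k.
  set t := T k in u34 en t0 *; set u := t + c in u34 en *.
  have dk : delta * theta ^+ k <= delta by rewrite ler_piMr// ltW.
  have CdA : C * `|y u - x t| <= A * (1 - theta) * theta ^+ k.
    rewrite AE -(ler_pM2l c10) mulrCA.
    have := ler_wpM2l (ltW C0) en.
    rewrite (_ : c1 * (C * delta / c1 * theta ^+ k) = C * (delta * theta ^+ k))//.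
    by field; rewrite gt_eqF.
  have CdA4 : C * `|y u - x t| <= h / 4.
    apply: le_trans CdA _; apply: le_trans Ah.
    rewrite -mulrA ler_piMr ?(ltW A0)// mulr_ile1 ?(ltW th1') ?(ltW thk0)//; lra.
  have small (e : 'rV[R]_n) (rho : R) : c1 * `|e| <= delta * theta ^+ k ->
      delta <= c1 * rho / 2 -> 0 < rho -> `|e| < rho.
    move=> H1 H2 rho0; rewrite -(ltr_pM2l c10).
    have : 0 < c1 * rho by rewrite mulr_gt0.
    lra.
  have [|||u' uu'] := remin (x t) y u (Kx t t0) oy; first by apply: neq; lra.
  - exact: small en dB rhoB0.
  - by lra.
  have u'0 : 0 <= u' by move: uu'; rewrite ler_norml; lra.
  case=> [yx|[V1 V2]]; first by have := neq t u' t0 u'0; rewrite yx subrr eqxx.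
  exists (u' - t).
  have uu : u' - t - c = u' - u by rewrite /u; ring.
  have cc' : `|u' - t - c| <= A * (1 - theta) * theta ^+ k.
    by rewrite uu; exact: le_trans CdA.
  split=> //; split.
    have [cb _] := Pc.
    rewrite -[X in `|X|](subrK c) (le_trans (ler_normD _ _))// exprS; lra.
  have := contr _ _ (orbit_in_shift t0 ox) (orbit_in_shift u'0 oy).
  rewrite !addr0 => /(_ (neq _ _ t0 u'0)) H.
  have V3 : V (x t) (y u' - x t) <= delta * theta ^+ k.
    by apply: le_trans V1 _; have [] := Pc.
  have V4 := le_trans (Vc1 _ _ (Kx t t0) (neq _ _ t0 u'0)) V3.
  have := H (small _ _ V4 dA rhoA0) V2.
  rewrite TS -/t (_ : t + h + (u' - t) = u' + h); last by ring.
  move=> /le_trans; apply; rewrite exprS mulrCA ler_wpM2l//.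
  exact: ltW.
have step (kc : nat * R) : exists c', P kc.1 kc.2 -> P kc.1.+1 c' /\
    `|c' - kc.2| <= A * (1 - theta) * theta ^+ kc.1.
  by have [/Pstep[c' ?]|?] := pselect (P kc.1 kc.2); [exists c'|exists 0].
have [g gP] := choice step.
pose c_ := fix c_ k := if k is j.+1 then g (j, c_ j) else 0.
have Pc k : P k (c_ k) by elim: k => [//|k /(gP (k, _))[]].
have [c cP] : exists c, forall k, `|c - c_ k| <= A * theta ^+ k.
  apply: geometric_limit => // [|k]; first by rewrite th0.
  by have [] := gP (k, c_ k) (Pc k).
clear contr remin dA dB dC AE L4 eta0 rhoA0 rhoB0 xy0 P0 Pstep step gP.
exists c; apply/cvgrPdist_lt => e e0.
pose Q := 2 * delta / c1 + M * A.
have Q0 : 0 < Q by rewrite addr_gt0 ?divr_gt0 ?mulr_gt0.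
have [N thN] : exists N, Q * theta ^+ N < e.
  have : \forall N \near \oo, theta ^+ N < e / Q.
    have : (fun N => theta ^+ N) @ \oo --> (0 : R).
      by apply: cvg_expr; rewrite ger0_norm ?ltW.
    by move/cvgr_lt; apply; rewrite divr_gt0.
  by move=> [N _ /(_ N (leqnn N))]; rewrite /= ltr_pdivlMr// mulrC; exists N.
near=> t.
have tN : T N.+1 <= t by near: t; apply: nbhs_pinfty_ge; exact: num_real.
have [k [Nk Tk kT]] : exists k, [/\ (N <= k)%N, T k <= t & t <= T k + h].
  pose z := t / h.
  have zN : N.+2%:R <= z by rewrite /z ler_pdivlMr.
  have z0 : 0 <= z by apply: le_trans zN.
  have /andP[z1 z2] := truncn_itv z0.
  have Nz : (N.+2 <= Num.truncn z)%N by rewrite truncn_ge_nat.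
  have tE : t = z * h by rewrite /z divfK// gt_eqF.
  exists (Num.truncn z).-1; split; first by rewrite -ltnS prednK// (leq_trans _ Nz).
    by rewrite /T prednK ?(leq_trans _ Nz)// tE ler_pM2r.
  rewrite -TS /T prednK ?(leq_trans _ Nz)// tE ler_pM2r//; exact: ltW.
have ck := cA k (c_ k) (Pc k); have en := enorm k (c_ k) (Pc k).
have u34 := uT k _ ck; have Tk0 : 0 <= T k by have := Th k; lra.
have Tc0 : 0 <= T k + c_ k by lra.
have tTk : 0 <= t - T k by rewrite subr_ge0.
have tTh : 4 * L * (t - T k) <= 1.
  by apply: le_trans hL; rewrite ler_wpM2l ?(ltW L40)//; lra.
have sep := orbit_separation L0 fL (orbit_in_shift Tk0 ox)
  (orbit_in_shift Tc0 oy) tTk tTh.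
rewrite !addr0 in sep.
have tE : T k + (t - T k) = t by ring.
have uE : T k + c_ k + (t - T k) = t + c_ k by ring.
rewrite tE uE in sep.
have cc0 : `|c| <= h / 4.
  have := cP 0%N; rewrite subr0 expr0 mulr1 => /le_trans; exact.
have cc1 : - (h / 4) <= c by move: cc0; rewrite ler_norml => /andP[].
have ck1 : - (h / 4) <= c_ k by move: ck; rewrite ler_norml => /andP[].
have ht : h <= t by exact: le_trans (Th k) Tk.
have speed : `|y (t + c) - y (t + c_ k)| <= M * (A * theta ^+ k).
  have tc0 : 0 <= t + c by lra.
  have tck0 : 0 <= t + c_ k by lra.
  apply: le_trans (orbit_lipschitz fM oy tck0 tc0) _.
  by rewrite ler_wpM2l ?(ltW M0)// (_ : t + c - _ = c - c_ k)//; ring.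
set e1 := y (t + c_ k) - x t in sep *.
set e2 := y (T k + c_ k) - x (T k) in sep en *.
have H1 : `|e1| <= 2 * `|e2|.
  rewrite -[X in `|X| <= _](subrK e2); apply: le_trans (ler_normD _ _) _.
  have : 2 * L * (t - T k) * `|e2| <= `|e2| by rewrite ler_piMl//; lra.
  lra.
have H2 : `|e2| <= delta * theta ^+ k / c1 by rewrite ler_pdivlMr// mulrC.
have -> : 0 - (x t - y (t + c)) = (y (t + c) - y (t + c_ k)) + e1.
  by rewrite sub0r opprB /e1 addrA subrK.
apply: le_lt_trans (ler_normD _ _) _; apply: le_lt_trans thN.
have H3 : Q * theta ^+ k <= Q * theta ^+ N.
  by rewrite ler_wpM2l ?(ltW Q0)// ler_wiXn2l// ltW.
apply: le_trans H3; rewrite /Q mulrDl; rewrite addrC lerD//; last by rewrite -mulrA.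
have : 2 * delta / c1 * theta ^+ k = 2 * (delta * theta ^+ k / c1) by ring.
lra.
Unshelve. all: by end_near. Qed.

End LocalPhase.

(** * From nearby orbits to all orbits *)

Lemma phase_related_trans (R : realType) (n : nat) (x y z : R -> 'rV[R]_n) :
  phase_related x y -> phase_related y z -> phase_related x z.
Proof.
move=> [c xy] [d yz]; exists (c + d).
have shift : t + c @[t --> +oo] --> +oo.
  apply/cvgryPge => A; near=> t; rewrite -lerBlDr; near: t.
  by apply: nbhs_pinfty_ge; exact: num_real.
have E : (fun t => x t - z (t + (c + d))) =
    (fun t => x t - y (t + c)) +
    ((fun t => y t - z (t + d)) \o (fun t => t + c)).
  by apply/funext => t; rewrite fctE/= addrA subrKA.
by rewrite E -[X in _ --> X]addr0; apply: cvgD xy (cvg_comp _ _ shift yz).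
Unshelve. all: by end_near. Qed.

Lemma path_phase (R : realType) (n : nat) (K : set 'rV[R]_n)
    (f : 'rV[R]_n -> 'rV[R]_n) (eps : R) (x y : R -> 'rV[R]_n) :
  smoothly_path_connected K -> strictly_forward_invariant K f ->
  solutions_exist K f -> 0 < eps ->
  (forall x y, orbit_in K f x -> orbit_in K f y -> `|y 0 - x 0| < eps ->
    phase_related x y) ->
  orbit_in K f x -> orbit_in K f y -> phase_related x y.
Proof.
move=> Kconn Kinv fex eps0 local ox oy.
have [_ Kx] := ox; have [_ Ky] := oy.
have [gam [sgam gam0 gam1 Kgam]] := Kconn _ _ (Kx 0 (lexx 0)) (Ky 0 (lexx 0)).
have [s s01|r r0 gamr] := @compact_unif_continuous R R^o _ `[0, 1] gam eps
    (@segment_compact _ _ _) _ eps0.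
  exact/differentiable_continuous/(smooth_on_differentiable sgam).
pose N := (Num.truncn r^-1).+1.
have rN : N%:R^-1 < r.
  rewrite -[ltRHS]invrK ltf_pV2 ?posrE ?invr_gt0 ?ltr0n//.
  exact: truncnS_gt.
pose s (i : nat) : R := i%:R / N%:R.
have s01 i : (i <= N)%N -> 0 <= s i <= 1.
  move=> iN; rewrite /s divr_ge0 ?ler0n//= ler_pdivrMr ?ltr0n// mul1r.
  by rewrite ler_nat.
have chain i : (i <= N)%N -> forall z, orbit_in K f z -> z 0 = gam (s i) ->
    phase_related x z.
  elim: i => [|i IH] iN z oz z0.
    by apply: local => //; rewrite z0 /s mul0r gam0 subrr normr0.
  have [w [sw w0]] := fex _ (Kgam _ (s01 i (ltnW iN))).
  have ow : orbit_in K f w.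
    by apply: solution_orbit_in => //; rewrite w0; apply/Kgam/s01/ltnW.
  apply: phase_related_trans (IH (ltnW iN) w ow w0) _.
  apply: local => //; rewrite z0 w0; apply: gamr; first exact: s01 (ltnW iN).
  rewrite /s -mulrBl -natr1 addrAC subrr add0r mul1r.
  by rewrite ger0_norm ?invr_ge0.
apply: (chain N) => //; rewrite /s divff ?gam1// pnatr_eq0.
by [].
Qed.

(** The plain shift t + c takes negative values near t = 0 when c < 0. Letting
    the shift grow from 0 to c at a slow exponential rate avoids this, and the
    family F below is stable under differentiation, whence smoothness. *)
Lemma reparametrized_shift (R : realType) (c k : R) :
  0 < k -> k * `|c| < 1 ->
  time_reparametrization (fun t => t + c - c * expR (- k * t)).
Proof.
move=> k0 kc; pose F (a b p t : R) : R := a * t + b + p * expR (- k * t).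
have Fd a b p (t : R) : is_derive t 1 (F a b p) (F 0 a (- (k * p)) t).
  have dl (m : R) : is_derive t 1 (fun r : R => m * r) m.
    rewrite (_ : (fun r => m * r) = (fun r => r *: (m : R^o))).
      exact: is_derive_scalel.
    by apply/funext => r; rewrite mulrC.
  have de := @is_derive1_comp R expR (fun r : R => - k * r) t _ _
    (is_derive_expR _) (dl (- k)).
  have da : is_derive t 1 (fun r : R => a * r + b) a.
    by rewrite -[X in is_derive _ _ _ X]addr0; apply: is_deriveD.
  have dp : is_derive t 1 (fun r : R => p * expR (- k * r)) (- (k * p) * expR (- k * t)).
    apply: (is_derive_eq (@is_deriveZ R R^o R^o _ p t 1 _ de)).
    by rewrite /GRing.scale/= !mulrN !mulNr mulrCA mulrC (mulrC p k).
  have := is_deriveD da dp; rewrite /F mul0r add0r; exact.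
have Fdiff a b p (t : R) : differentiable (F a b p : R^o -> R^o) t.
  by apply/derivable1_diffP; have [] := Fd a b p t.
have FD a b p (v : R) : 'D_v (F a b p : R^o -> R^o) =
    F 0 (v * a) (v * - (k * p)).
  apply/funext => t; rewrite deriveE// -[v in LHS]mulr1 -[v * 1]/(v *: (1 : R^o)).
  rewrite linearZ -deriveE//; have [_ ->] := Fd a b p t.
  by rewrite -[LHS]/(v * F 0 a (- (k * p)) t) /F !mul0r !add0r mulrDr mulrA.
have E1 (r : R) : 0 <= r -> 0 < expR (- k * r) <= 1.
  by move=> r0; rewrite expR_gt0 -expR0 ler_expR mulNr oppr_le0 mulr_ge0// ltW.
have /andP[c1 c2] : - `|c| <= c <= `|c| by rewrite -ler_norml.
have FE r : F 1 c (- c) r = r + c - c * expR (- k * r).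
  by rewrite /F mul1r !mulNr.
rewrite (_ : (fun t => _) = F 1 c (- c)); last first.
  by apply/funext => r; rewrite FE.
split.
- exists setT; split=> [|//|vs t _]; first exact: openT.
  suff [a [b [p ->]]] : exists a b p, iter_derive (R := R) (E := R^o) (F := R^o)
      vs (F 1 c (- c)) = F a b p by exact: Fdiff.
  elim: vs => [|v vs [a [b [p IH]]]] /=; first by exists 1, c, (- c).
  by rewrite -/(iter_derive _ _) IH FD; exists 0, (v * a), (v * - (k * p)).
- move=> r r0; rewrite FE; have /andP[e0 e1] := E1 r r0.
  have e2 : 1 - expR (- k * r) <= k * r.
    by have := expR_ge1Dx (- k * r); lra.
  have : `|c| * (1 - expR (- k * r)) <= `|c| * (k * r) by rewrite ler_wpM2l.
  have : k * `|c| * r <= r by rewrite ler_piMl// ltW.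
  have : - `|c| * (1 - expR (- k * r)) <= c * (1 - expR (- k * r)).
    by rewrite ler_wpM2r// subr_ge0.
  lra.
- move=> r s; rewrite !in_itv/= !andbT => r0 _ rs.
  have Fc : {within `[r, s], continuous (F 1 c (- c))}.
    by apply: derivable_within_continuous => q _; have [] := Fd 1 c (- c) q.
  have [d] := MVT rs (fun q _ => Fd 1 c (- c) q) Fc.
  rewrite in_itv/= => /andP[rd _] dE; rewrite -subr_gt0 dE mulr_gt0 ?subr_gt0//.
  have /andP[e0 e1] := E1 d (le_trans r0 (ltW rd)).
  have : - 1 < k * c.
    by have : k * - `|c| <= k * c by [rewrite ler_wpM2l// ltW]; lra.
  rewrite /F; nra.
- apply/cvgryPge => A; near=> r; rewrite FE.
  have r0 : 0 <= r by near: r; apply: nbhs_pinfty_ge; exact: num_real.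
  have Ar : A - c + `|c| <= r by near: r; apply: nbhs_pinfty_ge; exact: num_real.
  have /andP[e0 e1] := E1 r r0.
  have : c * expR (- k * r) <= `|c|.
    by apply: le_trans (ler_norm _) _; rewrite normrM ler_piMr// ger0_norm// ltW.
  lra.
Unshelve. all: by end_near. Qed.

Theorem theorem1 (R : realType) (n : nat) (K : set 'rV[R]_n)
  (f : 'rV[R]_n -> 'rV[R]_n) (lambda : R) (V : 'rV[R]_n -> 'rV[R]_n -> R)
  (f_smooth : smooth_on K f)
  (f_exist : solutions_exist K f)
  (f_unique : solutions_unique K f)
  (K_compact : compact K)
  (K_connected : smoothly_path_connected K)
  (K_invariant : strictly_forward_invariant K f)
  (lambda_gt0 : 0 < lambda)
  (V_finsler : finsler_metric K V)
  (V_contracting : forall x d : 'rV[R]_n, K x -> d != 0 ->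
     'd (fun e : 'rV[R]_n => V x e) d (f x) = 0 ->
     'd (fun y : 'rV[R]_n => V y d) x (f x)
       + 'd (fun e : 'rV[R]_n => V x e) d (d *m 'J f x)
     <= - lambda * V x d) :
  forall x1 x2 : R -> 'rV[R]_n,
    is_solution f x1 -> is_solution f x2 -> K (x1 0) -> K (x2 0) ->
    exists tau : R -> R,
      time_reparametrization tau /\
      `|x1 t - x2 (tau t)| @[t --> +oo] --> 0.
Proof.
move=> x1 x2 sx1 sx2 Kx1 Kx2.
have ox1 := solution_orbit_in K_invariant sx1 Kx1.
have ox2 := solution_orbit_in K_invariant sx2 Kx2.
have [M M0 fM] := compact_norm_le K_compact (continuous_field f_smooth).
have [eps eps0 local] := local_phase f_smooth f_unique K_compact lambda_gt0
  V_finsler V_contracting.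
have [c x12] := path_phase K_connected K_invariant f_exist eps0 local ox1 ox2.
pose k := (2 * (`|c| + 1))^-1.
have c1 : 0 < `|c| + 1 by rewrite ltr_wpDl.
have k0 : 0 < k by rewrite invr_gt0 mulr_gt0.
have kc : k * `|c| < 1.
  by rewrite mulrC ltr_pdivrMr ?mulr_gt0//; lra.
have tauP := reparametrized_shift k0 kc.
exists (fun t => t + c - c * expR (- k * t)); split=> //.
have [_ tau0 _ _] := tauP.
have slip : M * (`|c| * expR (- k * t)) @[t --> +oo] --> (0 : R).
  rewrite -[X in _ --> X](mulr0 M); apply: cvgM; first exact: cvg_cst.
  rewrite -[X in _ --> X](mulr0 `|c|); apply: cvgM; first exact: cvg_cst.
  have kt : k * t @[t --> +oo] --> +oo.
    apply/cvgryPge => A; near=> t.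
    have At : A / k <= t by near: t; apply: nbhs_pinfty_ge; exact: num_real.
    by rewrite mulrC -ler_pdivrMr.
  have := cvg_comp _ _ kt (@cvgr_expR R).
  by rewrite (_ : _ \o _ = (fun t => expR (- k * t)))//; apply/funext => t;
    rewrite /= mulNr.
have x12n : `|x1 t - x2 (t + c)| @[t --> +oo] --> (0 : R).
  by rewrite -[X in _ --> X](normr0 'rV[R]_n); exact: cvg_norm x12.
have bound : `|x1 t - x2 (t + c)| + M * (`|c| * expR (- k * t)) @[t --> +oo]
    --> (0 : R).
  by rewrite -[X in _ --> X]addr0; exact: cvgD.
apply: (@squeeze_cvgr _ _ _ R (fun=> 0) _ _ _ 0 (cvg_cst _) bound); near=> t.
have t0 : 0 <= t by near: t; apply: nbhs_pinfty_ge; exact: num_real.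
have tc0 : - c <= t by near: t; apply: nbhs_pinfty_ge; exact: num_real.
rewrite normr_ge0/=.
have -> : x1 t - x2 (t + c - c * expR (- k * t)) = x1 t - x2 (t + c)
    + (x2 (t + c) - x2 (t + c - c * expR (- k * t))) by rewrite subrKA.
apply: le_trans (ler_normD _ _) _; rewrite lerD2l.
apply: le_trans (orbit_lipschitz fM ox2 (tau0 t t0) _) _; first by lra.
rewrite opprB addrC subrK ler_wpM2l ?(ltW M0)// normrM.
by rewrite (ger0_norm (expR_ge0 _)).
Unshelve. all: by end_near. Qed.
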